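(* Let $\mathcal C$ be a strict braided monoidal category in which every idempotent splits and which admits coequalizers. Let $H$ be a weak Hopf quasigroup in $\mathcal C$ such that the functor $-\otimes H$ preserves coequalizers. Then the category $\mathcal{SM}^{H}_{H}$ of right-right strong $H$-Hopf modules is equivalent to the category $\mathcal C_{H_L}$ of right $H_L$-modules, where $H_L$ is the image of the target morphism $\Pi_H^L$ of $H$.
   Context: Conventions. $\mathcal C$ has tensor product $\otimes$, unit object $K$, braiding $c$. For an object $P$ and a morphism $f$, write $P\otimes f$ for $id_P\otimes f$ and $f\otimes P$ for $f\otimes id_P$. A unital magma is $(A,\eta_A,\mu_A)$ with $\eta_A:K\to A$, $\mu_A:A\otimes A\to A$ and $\mu_A\circ(A\otimes\eta_A)=id_A=\mu_A\circ(\eta_A\otimes A)$ (associativity not required; if associative, it is a monoid). A comonoid $(D,\varepsilon_D,\delta_D)$ is counital and coassociative. For $f,g:D\to A$ put $f\ast g=\mu_A\circ(f\otimes g)\circ\delta_D$. Put $\delta_{H\otimes H}=(H\otimes c_{H,H}\otimes H)\circ(\delta_H\otimes\delta_H)$. Weak Hopf quasigroup. $H$ is a unital magma $(H,\eta_H,\mu_H)$ and a comonoid $(H,\varepsilon_H,\delta_H)$ such that: (a1) $\delta_H\circ\mu_H=(\mu_H\otimes\mu_H)\circ\delta_{H\otimes H}$. (a2) $\varepsilon_H\circ\mu_H\circ(\mu_H\otimes H)=\varepsilon_H\circ\mu_H\circ(H\otimes\mu_H)=((\varepsilon_H\circ\mu_H)\otimes(\varepsilon_H\circ\mu_H))\circ(H\otimes\delta_H\otimes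 H)=((\varepsilon_H\circ\mu_H)\otimes(\varepsilon_H\circ\mu_H))\circ(H\otimes(c_{H,H}^{-1}\circ\delta_H)\otimes H)$. (a3) $(\delta_H\otimes H)\circ\delta_H\circ\eta_H=(H\otimes\mu_H\otimes H)\circ((\delta_H\circ\eta_H)\otimes(\delta_H\circ\eta_H))=(H\otimes(\mu_H\circ c_{H,H}^{-1})\otimes H)\circ((\delta_H\circ\eta_H)\otimes(\delta_H\circ\eta_H))$. (a4) There is $\lambda_H:H\to H$ (antipode) such that, with $\Pi_H^L=id_H\ast\lambda_H$ (target morphism) and $\Pi_H^R=\lambda_H\ast id_H$ (source morphism): (a4-1) $\Pi_H^L=((\varepsilon_H\circ\mu_H)\otimes H)\circ(H\otimes c_{H,H})\circ((\delta_H\circ\eta_H)\otimes H)$; (a4-2) $\Pi_H^R=(H\otimes(\varepsilon_H\circ\mu_H))\circ(c_{H,H}\otimes H)\circ(H\otimes(\delta_H\circ\eta_H))$; (a4-3) $\lambda_H\ast\Pi_H^L=\Pi_H^R\ast\lambda_H=\lambda_H$; (a4-4) $\mu_H\circ(\lambda_H\otimes\mu_H)\circ(\delta_H\otimes H)=\mu_H\circ(\Pi_H^R\otimes H)$; (a4-5) $\mu_H\circ(H\otimes\mu_H)\circ(H\otimes\lambda_H\otimes H)\circ(\delta_H\otimes H)=\mu_H\circ(\Pi_H^L\otimes H)$; (a4-6) $\mu_H\circ(\mu_H\otimes\lambda_H)\circ(H\otimes\delta_H)=\mu_H\circ(H\otimes\Pi_H^L)$; (a4-7) $\mu_H\circ(\mu_H\otimes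 H)\circ(H\otimes\lambda_H\otimes H)\circ(H\otimes\delta_H)=\mu_H\circ(H\otimes\Pi_H^R)$. The monoid $H_L$. $\Pi_H^L$ is idempotent (known). $H_L$ is its image, with $p_L:H\to H_L$, $i_L:H_L\to H$ such that $\Pi_H^L=i_L\circ p_L$, $p_L\circ i_L=id_{H_L}$. It is a monoid (known) with $\eta_{H_L}=p_L\circ\eta_H$ and $\mu_{H_L}=p_L\circ\mu_H\circ(i_L\otimes i_L)$. $\mathcal C_{H_L}$ is the category of right $H_L$-modules: objects $(N,\psi_N)$ with $\psi_N:N\otimes H_L\to N$ associative and unital; morphisms $f:N\to P$ with $\psi_P\circ(f\otimes H_L)=f\circ\psi_N$. Hopf modules. A right-right $H$-Hopf module is $(M,\phi_M,\rho_M)$ with $\phi_M:M\otimes H\to M$, $\rho_M:M\to M\otimes H$ such that: (b1) $(M,\rho_M)$ is a right $H$-comodule; (b2-1) $\phi_M\circ(M\otimes\eta_H)=id_M$; (b2-2) $\rho_M\circ\phi_M=(\phi_M\otimes\mu_H)\circ(M\otimes c_{H,H}\otimes H)\circ(\rho_M\otimes\delta_H)$; (b3) $\phi_M\circ(\phi_M\otimes\lambda_H)\circ(M\otimes\delta_H)=\phi_M\circ(M\otimes\Pi_H^L)$; (b4) $\phi_M\circ(\phi_M\otimes H)\circ(M\otimes\lambda_H\otimes H)\circ(M\otimes\delta_H)=\phi_M\circ(M\otimes\Pi_H^R)$; (b5) $\phi_M\circ(\phi_M\otimes H)\circ(M\otimes\Pi_H^L\otimes H)\circ(M\otimes\delta_H)=\phi_M$.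 Put $q_M=\phi_M\circ(M\otimes\lambda_H)\circ\rho_M:M\to M$ and $\phi_M^{\alpha_M}=\phi_M\circ(q_M\otimes\mu_H)\circ(\rho_M\otimes H):M\otimes H\to M$. A morphism of right-right $H$-Hopf modules $f:M\to N$ is a morphism of right $H$-comodules that is $H$-quasilineal, i.e. $\phi_N^{\alpha_N}\circ(f\otimes H)=f\circ\phi_M^{\alpha_M}$. The resulting category is $\mathcal M^H_H$. Strong Hopf modules. $\mathcal{SM}^H_H$ is the full subcategory of $\mathcal M^H_H$ whose objects (right-right strong $H$-Hopf modules) satisfy $\phi_M\circ((\phi_M\circ(M\otimes i_L))\otimes H)=\phi_M\circ(M\otimes(\mu_H\circ(i_L\otimes H)))$. *)

(* Defs.v *)
From Corelib Require Import ssreflect.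
From Stdlib Require Import ProofIrrelevance.

Set Implicit Arguments.
Unset Strict Implicit.
Unset Printing Implicit Defensive.
Set Warnings "-uniform-inheritance".

Record category := Category {
  obj :> Type;
  hom : obj -> obj -> Type;
  idm : forall A, hom A A;
  comp : forall A B D, hom B D -> hom A B -> hom A D;
  comp_idl : forall A B (f : hom A B), comp (idm B) f = f;
  comp_idr : forall A B (f : hom A B), comp f (idm A) = f;
  comp_assoc : forall A B D E (h : hom D E) (g : hom B D) (f : hom A B),
    comp h (comp g f) = comp (comp h g) f
}.
Arguments hom {c} A B.
Arguments idm {c} A.
Arguments comp {c A B D} g f.

(* An object is read as its identity wherever a morphism is expected, so that
   [P ⊗ f] below means [idm P ⊗ f]. *)
Coercion idm : obj >-> hom.

Record functor (C D : category) := Functor {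
  fobj :> C -> D;
  fmap : forall A B, hom A B -> hom (fobj A) (fobj B);
  fmap_id : forall A, fmap (idm A) = idm (fobj A);
  fmap_comp : forall A B E (g : hom B E) (f : hom A B),
    fmap (comp g f) = comp (fmap g) (fmap f)
}.
Arguments fmap {C D} _ {A B} _.

Definition functor_id (C : category) : functor C C :=
  @Functor C C (fun A => A) (fun A B f => f)
    (fun A => eq_refl) (fun A B E g f => eq_refl).

Definition functor_comp (C D E : category) (G : functor D E) (F : functor C D) :
  functor C E.
Proof.
refine (@Functor C E (fun A => G (F A)) (fun A B f => fmap G (fmap F f)) _ _).
- by move=> A; rewrite !fmap_id.
- by move=> A B X g f; rewrite !fmap_comp.
Defined.

Definition is_iso (C : category) (A B : C) (f : hom A B) : Prop :=
  exists g : hom B A, comp g f = idm A /\ comp f g = idm B.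

Definition naturally_isomorphic (C D : category) (F G : functor C D) : Prop :=
  exists a : forall A : C, hom (F A) (G A),
    (forall (A B : C) (f : hom A B), comp (a B) (fmap F f) = comp (fmap G f) (a A))
    /\ (forall A : C, is_iso (a A)).

Definition equivalent (C D : category) : Prop :=
  exists (F : functor C D) (G : functor D C),
    naturally_isomorphic (functor_comp G F) (functor_id C)
    /\ naturally_isomorphic (functor_comp F G) (functor_id D).

Record splitting (C : category) (A : C) (e : hom A A) := Splitting {
  img :> C;
  proj : hom A img;
  incl : hom img A;
  incl_proj : comp incl proj = e;
  proj_incl : comp proj incl = idm img
}.

Definition idempotents_split (C : category) : Prop :=
  forall (A : C) (e : hom A A), comp e e = e -> inhabited (splitting e).

Definition is_coequalizer (C : category) (A B Q : C) (f g : hom A B) (q : hom B Q) :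
  Prop :=
  comp q f = comp q g
  /\ forall (E : C) (h : hom B E), comp h f = comp h g ->
       exists! u : hom Q E, comp u q = h.

Definition has_coequalizers (C : category) : Prop :=
  forall (A B : C) (f g : hom A B),
    exists (Q : C) (q : hom B Q), is_coequalizer f g q.

Section Structured.

Context (C : category) (S : Type) (u : S -> C).
Context (P : forall X Y : S, hom (u X) (u Y) -> Prop).
Arguments P {X Y} _.
Context (P_id : forall X : S, P (idm (u X))).
Context (P_comp : forall (X Y Z : S) (g : hom (u Y) (u Z)) (f : hom (u X) (u Y)),
  P g -> P f -> P (comp g f)).

Record structured_hom (X Y : S) := StructuredHom {
  underlying :> hom (u X) (u Y);
  underlyingP : P underlying
}.

Lemma structured_hom_eq (X Y : S) (f g : structured_hom X Y) :
  underlying f = underlying g -> f = g.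
Proof.
case: f g => [f Pf] [g Pg] /= e; subst g.
by rewrite (proof_irrelevance _ Pf Pg).
Qed.

Definition structured_category : category.
Proof.
refine (@Category S structured_hom
  (fun X => StructuredHom (P_id X))
  (fun X Y Z g f => StructuredHom (P_comp (underlyingP g) (underlyingP f)))
  _ _ _).
- by move=> X Y f; apply: structured_hom_eq; apply: comp_idl.
- by move=> X Y f; apply: structured_hom_eq; apply: comp_idr.
- by move=> X Y Z T h g f; apply: structured_hom_eq; apply: comp_assoc.
Defined.

End Structured.

Definition full_subcategory (C : category) (P : C -> Prop) : category :=
  @Category {X : C | P X}
    (fun X Y => hom (proj1_sig X) (proj1_sig Y))
    (fun X => idm (proj1_sig X))
    (fun X Y Z g f => comp g f)
    (fun X Y f => comp_idl f)
    (fun X Y f => comp_idr f)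
    (fun X Y Z T h g f => comp_assoc h g f).

Record arrow (C : category) := Arrow { dom : C; cod : C; mor : hom dom cod }.
Arguments Arrow {C dom cod} mor.

Declare Scope cat_scope.
Delimit Scope cat_scope with C.
Bind Scope cat_scope with obj.
Bind Scope cat_scope with hom.
Open Scope cat_scope.

(* Equality of morphisms whose domains (and codomains) are equal without being
   convertible, such as [(A ⊗ B) ⊗ D] and [A ⊗ (B ⊗ D)]. *)
Notation "f ≈ g" := (Arrow f = Arrow g)
  (at level 70, no associativity) : cat_scope.

Reserved Notation "A ⊠ B" (at level 40, left associativity).
Reserved Notation "f ⊗ g" (at level 40, left associativity).

Record strict_monoidal := StrictMonoidal {
  smcat :> category;
  unit_obj : smcat;
  tens : smcat -> smcat -> smcat
    where "A ⊠ B" := (tens A B) : cat_scope;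
  tensm : forall A A' B B' : smcat,
    hom A A' -> hom B B' -> hom (A ⊠ B) (A' ⊠ B')
    where "f ⊗ g" := (tensm f g) : cat_scope;
  tens_assoc : forall A B D : smcat, A ⊠ (B ⊠ D) = A ⊠ B ⊠ D;
  tens_unitl : forall A : smcat, unit_obj ⊠ A = A;
  tens_unitr : forall A : smcat, A ⊠ unit_obj = A;
  tensm_id : forall A B : smcat, idm A ⊗ idm B = idm (A ⊠ B);
  tensm_comp : forall (A A' A'' B B' B'' : smcat) (f' : hom A' A'') (f : hom A A')
      (g' : hom B' B'') (g : hom B B'),
    comp f' f ⊗ comp g' g = comp (f' ⊗ g') (f ⊗ g);
  tensm_assoc : forall (A A' B B' D D' : smcat)
      (f : hom A A') (g : hom B B') (h : hom D D'),
    f ⊗ (g ⊗ h) ≈ f ⊗ g ⊗ h;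
  tensm_unitl : forall (A A' : smcat) (f : hom A A'), unit_obj ⊗ f ≈ f;
  tensm_unitr : forall (A A' : smcat) (f : hom A A'), f ⊗ unit_obj ≈ f
}.
Arguments unit_obj {s}.
Arguments tens {s} A B.
Arguments tensm {s A A' B B'} _ _.

Notation "A ⊠ B" := (tens A B) : cat_scope.
Notation "f ⊗ g" := (tensm f g) : cat_scope.
Notation K := unit_obj.

(* [g ∘ f] composes [f : A -> B] with [g : B' -> D] when [B = B'] follows from
   strictness, the proof of this equality being found by [same_obj_tac]; it is
   [eq_refl], and [g ∘ f] is convertible to [comp g f], as soon as [B] and [B']
   are convertible. *)
Class same_obj (C : category) (A B : C) : Prop := same_objP : A = B.

Ltac same_obj_tac :=
  lazymatch goal with
  | |- @same_obj ?C ?A ?B =>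
    first [ exact (@eq_refl (obj C) A)
          | unfold same_obj; rewrite ?tens_unitl ?tens_unitr ?tens_assoc;
            reflexivity ]
  end.
Global Hint Extern 0 (same_obj _ _) => same_obj_tac : typeclass_instances.

Definition strict_comp (C : category) (A B B' D : C) (g : hom B' D) (f : hom A B)
    {e : same_obj B B'} : hom A D :=
  comp g (eq_rect B (hom A) f B' e).
Arguments strict_comp {C A B B' D} g f {e}.

Notation "g ∘ f" := (strict_comp g f)
  (at level 50, left associativity) : cat_scope.

Record strict_braided := StrictBraided {
  sbcat :> strict_monoidal;
  braid : forall A B : sbcat, hom (A ⊠ B) (B ⊠ A);
  braidV : forall A B : sbcat, hom (B ⊠ A) (A ⊠ B);
  braidK : forall A B : sbcat, braidV A B ∘ braid A B = idm (A ⊠ B);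
  braidVK : forall A B : sbcat, braid A B ∘ braidV A B = idm (B ⊠ A);
  braid_nat : forall (A A' B B' : sbcat) (f : hom A A') (g : hom B B'),
    braid A' B' ∘ (f ⊗ g) = (g ⊗ f) ∘ braid A B;
  braid_hexl : forall A B D : sbcat,
    braid A (B ⊠ D) ≈ (B ⊗ braid A D) ∘ (braid A B ⊗ D);
  braid_hexr : forall A B D : sbcat,
    braid (A ⊠ B) D ≈ (braid A D ⊗ B) ∘ (A ⊗ braid B D)
}.
Arguments braid {s} A B.
Arguments braidV {s} A B.

Section WeakHopfQuasigroup.

Context (C : strict_braided).

Record is_unital_magma (A : C) (η : hom K A) (μ : hom (A ⊠ A) A) : Prop := {
  magma_unitr : μ ∘ (A ⊗ η) ≈ A;
  magma_unitl : μ ∘ (η ⊗ A) ≈ A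
}.

Record is_comonoid (D : C) (ε : hom D K) (δ : hom D (D ⊠ D)) : Prop := {
  comonoid_counitr : (D ⊗ ε) ∘ δ ≈ D;
  comonoid_counitl : (ε ⊗ D) ∘ δ ≈ D;
  comonoid_coassoc : (δ ⊗ D) ∘ δ ≈ (D ⊗ δ) ∘ δ
}.

Definition convolution (D A : C) (δ : hom D (D ⊠ D)) (μ : hom (A ⊠ A) A)
    (f g : hom D A) : hom D A :=
  μ ∘ (f ⊗ g) ∘ δ.

Record is_antipode (H : C) (η : hom K H) (μ : hom (H ⊠ H) H)
    (ε : hom H K) (δ : hom H (H ⊠ H)) (λ : hom H H) : Prop := {
  antipode_target : convolution δ μ H λ
    ≈ ((ε ∘ μ) ⊗ H) ∘ (H ⊗ braid H H) ∘ ((δ ∘ η) ⊗ H);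
  antipode_source : convolution δ μ λ H
    ≈ (H ⊗ (ε ∘ μ)) ∘ (braid H H ⊗ H) ∘ (H ⊗ (δ ∘ η));
  antipode_conv_target :
    convolution δ μ λ (convolution δ μ H λ) = λ;
  antipode_source_conv :
    convolution δ μ (convolution δ μ λ H) λ = λ;
  antipode_mulVK :
    μ ∘ (λ ⊗ μ) ∘ (δ ⊗ H) = μ ∘ (convolution δ μ λ H ⊗ H);
  antipode_mulKV :
    μ ∘ (H ⊗ μ) ∘ (H ⊗ λ ⊗ H) ∘ (δ ⊗ H) = μ ∘ (convolution δ μ H λ ⊗ H);
  antipode_mulK :
    μ ∘ (μ ⊗ λ) ∘ (H ⊗ δ) = μ ∘ (H ⊗ convolution δ μ H λ);
  antipode_mulVKr :
    μ ∘ (μ ⊗ H) ∘ (H ⊗ λ ⊗ H) ∘ (H ⊗ δ) = μ ∘ (H ⊗ convolution δ μ λ H)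
}.

(* The antipode is unique, so that making it a component of the structure amounts
   to asserting its existence. *)
Record weak_hopf_quasigroup := WeakHopfQuasigroup {
  whq_obj :> C;
  η : hom K whq_obj;
  μ : hom (whq_obj ⊠ whq_obj) whq_obj;
  ε : hom whq_obj K;
  δ : hom whq_obj (whq_obj ⊠ whq_obj);
  λ : hom whq_obj whq_obj;
  whq_magma : is_unital_magma η μ;
  whq_comonoid : is_comonoid ε δ;
  whq_comul_mul :
    δ ∘ μ = (μ ⊗ μ) ∘ ((whq_obj ⊗ braid whq_obj whq_obj ⊗ whq_obj) ∘ (δ ⊗ δ));
  whq_counit_assoc :
    ε ∘ μ ∘ (μ ⊗ whq_obj) ≈ ε ∘ μ ∘ (whq_obj ⊗ μ);
  whq_counit_mul :
    ε ∘ μ ∘ (whq_obj ⊗ μ)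
    ≈ ((ε ∘ μ) ⊗ (ε ∘ μ)) ∘ (whq_obj ⊗ δ ⊗ whq_obj);
  whq_counit_mulV :
    ε ∘ μ ∘ (whq_obj ⊗ μ)
    ≈ ((ε ∘ μ) ⊗ (ε ∘ μ))
      ∘ (whq_obj ⊗ (braidV whq_obj whq_obj ∘ δ) ⊗ whq_obj);
  whq_comul_unit :
    (δ ⊗ whq_obj) ∘ δ ∘ η
    ≈ (whq_obj ⊗ μ ⊗ whq_obj) ∘ ((δ ∘ η) ⊗ (δ ∘ η));
  whq_comul_unitV :
    (δ ⊗ whq_obj) ∘ δ ∘ η
    ≈ (whq_obj ⊗ (μ ∘ braidV whq_obj whq_obj) ⊗ whq_obj) ∘ ((δ ∘ η) ⊗ (δ ∘ η));
  whq_antipode : is_antipode η μ ε δ λ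
}.

End WeakHopfQuasigroup.

Arguments η {C w}.
Arguments μ {C w}.
Arguments ε {C w}.
Arguments δ {C w}.
Arguments λ {C w}.

Definition target (C : strict_braided) (H : weak_hopf_quasigroup C) : hom H H :=
  convolution δ μ H λ.
Definition source (C : strict_braided) (H : weak_hopf_quasigroup C) : hom H H :=
  convolution δ μ λ H.

(* The monoid axioms for [(A, eta, mu)] play no role in what a right module is,
   hence are not required here. *)
Section RightModules.

Context (C : strict_braided) (A : C) (eta : hom K A) (mu : hom (A ⊠ A) A).

Record right_module := RightModule {
  rm_obj :> C;
  act : hom (rm_obj ⊠ A) rm_obj;
  act_assoc : act ∘ (act ⊗ A) ≈ act ∘ (rm_obj ⊗ mu);
  act_unit : act ∘ (rm_obj ⊗ eta) ≈ rm_obj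
}.

Definition is_module_morphism (N P : right_module) (f : hom N P) : Prop :=
  act P ∘ (f ⊗ A) = f ∘ act N.

Lemma is_module_morphism_id (N : right_module) : is_module_morphism (idm N).
Proof.
by rewrite /is_module_morphism /strict_comp /= tensm_id comp_idl comp_idr.
Qed.

Lemma is_module_morphism_comp (N P Q : right_module)
    (g : hom P Q) (f : hom N P) :
  is_module_morphism g -> is_module_morphism f -> is_module_morphism (comp g f).
Proof.
rewrite /is_module_morphism /strict_comp /= => Hg Hf.
rewrite -{1}(comp_idl (idm A)) tensm_comp comp_assoc Hg.
by rewrite -comp_assoc Hf comp_assoc.
Qed.

Definition right_modules : category :=
  structured_category is_module_morphism_id is_module_morphism_comp.

End RightModules.

Section HopfModules.

Context (C : strict_braided) (H : weak_hopf_quasigroup C).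

Record is_comodule (M : C) (ρ : hom M (M ⊠ H)) : Prop := {
  comodule_counit : (M ⊗ ε) ∘ ρ ≈ M;
  comodule_coassoc : (ρ ⊗ H) ∘ ρ ≈ (M ⊗ δ) ∘ ρ
}.

Record hopf_module := HopfModule {
  hm_obj :> C;
  φ : hom (hm_obj ⊠ H) hm_obj;
  ρ : hom hm_obj (hm_obj ⊠ H);
  hm_comodule : is_comodule ρ;
  hm_unit : φ ∘ (hm_obj ⊗ η) ≈ hm_obj;
  hm_coact_act :
    ρ ∘ φ = (φ ⊗ μ) ∘ (hm_obj ⊗ braid H H ⊗ H) ∘ (ρ ⊗ δ);
  hm_actK :
    φ ∘ (φ ⊗ λ) ∘ (hm_obj ⊗ δ) = φ ∘ (hm_obj ⊗ target H);
  hm_actVK :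
    φ ∘ (φ ⊗ H) ∘ (hm_obj ⊗ λ ⊗ H) ∘ (hm_obj ⊗ δ) = φ ∘ (hm_obj ⊗ source H);
  hm_act_target :
    φ ∘ (φ ⊗ H) ∘ (hm_obj ⊗ target H ⊗ H) ∘ (hm_obj ⊗ δ) = φ
}.

Definition q (M : hopf_module) : hom M M :=
  φ M ∘ (M ⊗ λ) ∘ ρ M.

Definition φα (M : hopf_module) : hom (M ⊠ H) M :=
  φ M ∘ (q M ⊗ μ) ∘ (ρ M ⊗ H).

Definition is_hopf_morphism (M N : hopf_module) (f : hom M N) : Prop :=
  ρ N ∘ f = (f ⊗ H) ∘ ρ M /\ φα N ∘ (f ⊗ H) = f ∘ φα M.

Lemma is_hopf_morphism_id (M : hopf_module) : is_hopf_morphism (idm M).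
Proof.
by split; rewrite /strict_comp /= tensm_id comp_idl comp_idr.
Qed.

Lemma is_hopf_morphism_comp (M N P : hopf_module) (g : hom N P) (f : hom M N) :
  is_hopf_morphism g -> is_hopf_morphism f -> is_hopf_morphism (comp g f).
Proof.
rewrite /is_hopf_morphism /strict_comp /= => -[Hg1 Hg2] [Hf1 Hf2]; split.
- rewrite comp_assoc Hg1 -comp_assoc Hf1 comp_assoc -tensm_comp.
  by rewrite comp_idl.
- rewrite -{1}(comp_idl (idm (whq_obj H))) tensm_comp comp_assoc Hg2.
  by rewrite -comp_assoc Hf2 comp_assoc.
Qed.

Definition hopf_modules : category :=
  structured_category is_hopf_morphism_id is_hopf_morphism_comp.

Definition is_strong (HL : splitting (target H)) (M : hopf_module) : Prop :=
  φ M ∘ ((φ M ∘ (M ⊗ incl HL)) ⊗ H) ≈ φ M ∘ (M ⊗ (μ ∘ (incl HL ⊗ H))).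

Definition strong_hopf_modules (HL : splitting (target H)) : category :=
  full_subcategory (C := hopf_modules) (is_strong HL).

Definition η_L (HL : splitting (target H)) : hom K HL := proj HL ∘ η.
Definition μ_L (HL : splitting (target H)) : hom (HL ⊠ HL) HL :=
  proj HL ∘ μ ∘ (incl HL ⊗ incl HL).

End HopfModules.

Definition tensor_preserves_coequalizers (C : strict_monoidal) (X : C) : Prop :=
  forall (A B Q : C) (f g : hom A B) (p : hom B Q),
    is_coequalizer f g p -> is_coequalizer (f ⊗ X) (g ⊗ X) (p ⊗ X).

(* Main.v *)
(** Write [h1 ⊗ h2] for the coproduct of [h], [1_1 ⊗ 1_2] for that of the unit, [Π] for
    the target morphism and [q] for [q_M]. A strong Hopf module [M] is sent to the image
    of [q], and an [H_L]-module [N] to [N ⊗_{H_L} H], a coequalizer.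

    The axioms give [h Π(k) = ε(h1 k) h2], and [y k = ε(y k1) k2] for [y] in [H_L]. Hence
    [δ(y k) = y k1 ⊗ k2], and elements of [H_L] associate with those of [H] on the left
    and in the middle of a product; this makes [N ⊗_{H_L} H] a strong Hopf module.

    For a Hopf module, everything rests on [ρ(q(m) h) = q(m) h1 ⊗ h2]. It holds as soon
    as the second leg of [ρ(q(m))] lies in [H_L], which follows from
    [λ(h2)_1 ⊗ h1 λ(h2)_2 = λ(h1) Π(h2)_1 ⊗ Π(h2)_2]: no formula for [δ ∘ λ] is needed.
    Then [m ⊗ h ↦ m h] and [m ↦ q(m_0) ⊗ m_1] are inverse isomorphisms between
    [im q ⊗_{H_L} H] and [M], and so are [n ↦ n ⊗ 1] and [n ⊗ h ↦ n Π(h)] between [N] and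
    the image of [q] on [N ⊗_{H_L} H]. *)

Require Import Defs.
From Corelib Require Import ssreflect.
From Stdlib Require Import ProofIrrelevance IndefiniteDescription.
From Stdlib Require List.
Import List.ListNotations.

Set Implicit Arguments.
Unset Strict Implicit.
Unset Printing Implicit Defensive.

Open Scope list_scope.
Open Scope cat_scope.

(** * Morphisms compared up to equality of their objects *)

Section Casts.
Context (C : category).

Definition cast_hom (A A' B B' : C) (eA : A = A') (eB : B = B') (f : hom A B) :
  hom A' B' :=
  eq_rect A (fun Z => hom Z B') (eq_rect B (hom A) f B' eB) A' eA.

Lemma cast_hom_arrow (A A' B B' : C) (eA : A = A') (eB : B = B') (f : hom A B) :
  cast_hom eA eB f ≈ f.
Proof. by subst. Qed.

Lemma arrow_cast (A A' B B' : C) (f : hom A B) (g : hom A' B') :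
  f ≈ g -> exists (eA : A = A') (eB : B = B'), cast_hom eA eB f = g.
Proof.
(* Generalized to arbitrary arrows, since the equality can be eliminated only when one of its sides
   is a variable. *)
have transport (a b : arrow C) : a = b ->
    exists (eA : dom a = dom b) (eB : cod a = cod b), cast_hom eA eB (mor a) = mor b.
  by move=> <-; exists eq_refl, eq_refl.
by move/transport.
Qed.

(** The casts run along equalities [A = A] and [B = B], which proof irrelevance makes trivial. *)
Lemma arrow_inj (A B : C) (f g : hom A B) : f ≈ g -> f = g.
Proof.
case/arrow_cast=> eA [eB <-].
by rewrite (proof_irrelevance _ eA eq_refl) (proof_irrelevance _ eB eq_refl).
Qed.

Lemma strict_comp_arrow (A B B' D A1 B1 D1 : C) (g : hom B' D) (f : hom A B)
    (e : same_obj B B') (g1 : hom B1 D1) (f1 : hom A1 B1) :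
  g1 ≈ g -> f1 ≈ f -> comp g1 f1 ≈ @strict_comp C A B B' D g f e.
Proof.
unfold same_obj in e; subst B'.
move=> /arrow_cast[eA [eB <-]] /arrow_cast[eA' [eB' <-]]; subst.
by rewrite (proof_irrelevance _ eB' eq_refl).
Qed.

Lemma comp_arrow (A B D A1 B1 D1 : C) (g : hom B D) (f : hom A B)
    (g1 : hom B1 D1) (f1 : hom A1 B1) :
  g1 ≈ g -> f1 ≈ f -> comp g1 f1 ≈ comp g f.
Proof. exact: (@strict_comp_arrow _ _ _ _ _ _ _ g f eq_refl). Qed.

End Casts.

(** * Right-nested tensor products *)

Section Lifting.
Context (C : strict_monoidal).

Fixpoint right_nest (a : list C) (X : C) : C :=
  match a with nil => X | A :: a => A ⊠ right_nest a X end.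

Fixpoint left_nest_from (A : C) (a : list C) : C :=
  match a with nil => A | B :: a => left_nest_from (A ⊠ B) a end.

(** [⊠] associates to the left, so an object such as [A ⊠ B ⊠ D] in an axiom is convertible to the
    [left_nest] of its factors. *)
Definition left_nest (a : list C) : C :=
  match a with nil => K | A :: a => left_nest_from A a end.

Lemma left_right_nest (a : list C) (X : C) : left_nest a ⊠ X = right_nest a X.
Proof.
case: a => [|A a] /=; first exact: tens_unitl.
elim: a A => [|B a IH] A //=; rewrite IH; symmetry.
exact: tens_assoc.
Qed.

(* [f ⊗ X] with domain and codomain nested to the right. Between right-nested objects
   composites need no cast: all cells of a string diagram become [rtens f X], whiskered on
   the left. *)
Definition rtens (a b : list C) (f : hom (left_nest a) (left_nest b)) (X : C) :
  hom (right_nest a X) (right_nest b X) :=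
  cast_hom (left_right_nest a X) (left_right_nest b X) (f ⊗ X).

Lemma rtens_arrow a b (f : hom (left_nest a) (left_nest b)) (X : C) : rtens f X ≈ f ⊗ X.
Proof. exact: cast_hom_arrow. Qed.

Lemma tensm_arrow (A A' B B' A1 A1' B1 B1' : C) (f : hom A A') (g : hom B B')
  (f1 : hom A1 A1') (g1 : hom B1 B1') :
  f1 ≈ f -> g1 ≈ g -> f1 ⊗ g1 ≈ f ⊗ g.
Proof.
by case/arrow_cast=> eA [eA' <-] /arrow_cast[eB [eB' <-]]; subst.
Qed.

Lemma idm_arrow (A B : C) : A = B -> idm A ≈ idm B.
Proof. by move->. Qed.

(** The lemmas from here to [rtens_tens] are rules of [nest]: each assembles a cast-free
    representative of [E ⊗ X] from representatives of the parts of [E]. *)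
Lemma rtens_comp (A B B' D X A1 B1 D1 : C) (g : hom B' D) (f : hom A B)
    (e : same_obj B B') (g1 : hom B1 D1) (f1 : hom A1 B1) :
  f1 ≈ f ⊗ X -> g1 ≈ g ⊗ X -> comp g1 f1 ≈ @strict_comp C A B B' D g f e ⊗ X.
Proof.
move=> Hf Hg; unfold same_obj in e; subst B'.
by rewrite (comp_arrow Hg Hf) /= -tensm_comp comp_idl.
Qed.

Lemma rtens_comp_typed (A B D X A1 B1 D1 : C) (g : hom B D) (f : hom A B)
    (g1 : hom B1 D1) (f1 : hom A1 B1) :
  f1 ≈ f ⊗ X -> g1 ≈ g ⊗ X -> comp g1 f1 ≈ comp g f ⊗ X.
Proof. exact: (@rtens_comp _ _ _ _ _ _ _ _ g f eq_refl). Qed.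

Lemma rtens_left (A B B' X B1 B1' : C) (f : hom B B') (f1 : hom B1 B1') :
  f1 ≈ f ⊗ X -> idm A ⊗ f1 ≈ (idm A ⊗ f) ⊗ X.
Proof. by move=> H; rewrite -tensm_assoc; apply: tensm_arrow. Qed.

Lemma rtens_left2 (A A' B B' X B1 B1' : C) (f : hom B B') (f1 : hom B1 B1') :
  f1 ≈ (idm A' ⊗ f) ⊗ X -> idm A ⊗ f1 ≈ (idm (A ⊠ A') ⊗ f) ⊗ X.
Proof.
move=> H; rewrite (rtens_left A H) -tensm_id.
exact: tensm_arrow (tensm_assoc _ _ _) eq_refl.
Qed.

Lemma rtens_leftK (B B' X B1 B1' : C) (f : hom B B') (f1 : hom B1 B1') :
  f1 ≈ f ⊗ X -> f1 ≈ (idm K ⊗ f) ⊗ X.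
Proof. by move->; apply: tensm_arrow => //; rewrite tensm_unitl. Qed.

Lemma rtens_right (A B B' X B1 B1' : C) (f : hom B B') (f1 : hom B1 B1') :
  f1 ≈ f ⊗ idm (A ⊠ X) -> f1 ≈ (f ⊗ idm A) ⊗ X.
Proof. by move->; rewrite -tensm_assoc tensm_id. Qed.

Lemma rtens_right2 (A A' B B' X B1 B1' : C) (f : hom B B') (f1 : hom B1 B1') :
  f1 ≈ (f ⊗ idm A ⊗ idm A') ⊗ X -> f1 ≈ (f ⊗ idm (A ⊠ A')) ⊗ X.
Proof.
move->; apply: tensm_arrow => //.
by rewrite -tensm_id tensm_assoc.
Qed.

Lemma rtens_rightK (B B' X B1 B1' : C) (f : hom B B') (f1 : hom B1 B1') :
  f1 ≈ f ⊗ X -> f1 ≈ (f ⊗ idm K) ⊗ X.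
Proof. by move->; apply: tensm_arrow => //; rewrite tensm_unitr. Qed.

Lemma rtens_tens (A A' B B' X E1 E2 E3 : C) (f : hom A A') (g : hom B B')
    (f1 : hom E1 E2) (g1 : hom E2 E3) :
  f1 ≈ (f ⊗ idm B) ⊗ X -> g1 ≈ (idm A' ⊗ g) ⊗ X -> comp g1 f1 ≈ (f ⊗ g) ⊗ X.
Proof.
move=> Hf Hg; rewrite (comp_arrow Hg Hf) -!tensm_comp.
by rewrite !comp_idl comp_idr.
Qed.

Lemma transfer (A B A' B' A1 B1 A2 B2 X : C) (L : hom A B) (R : hom A' B')
   (F : hom A1 B1) (G : hom A2 B2) :
  F ≈ L ⊗ X -> G ≈ R ⊗ X -> L ≈ R -> F ≈ G.
Proof. by move=> -> -> H; apply: tensm_arrow. Qed.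

(** For [X = K] the added factor disappears by strictness, so equations can be proved on cast-free
    representatives. *)
Lemma untransfer (A B A' B' A1 B1 A2 B2 : C) (L : hom A B) (R : hom A' B')
   (F : hom A1 B1) (G : hom A2 B2) :
  F ≈ L ⊗ K -> G ≈ R ⊗ K -> F ≈ G -> L ≈ R.
Proof. by rewrite !tensm_unitr => <- <-. Qed.

(* Contexts list the objects on the left of a morphism, the nearest first, so that
   [in_context (A :: l) X] and [in_context l (A ⊠ X)] are convertible. *)
Fixpoint in_context (l : list C) (X : C) : C :=
  match l with nil => X | A :: l => in_context l (A ⊠ X) end.

Fixpoint whisker (l : list C) : forall X Y : C, hom X Y -> hom (in_context l X) (in_context l Y) :=
  match l with
  | nil => fun X Y f => f
  | A :: l => fun X Y f => whisker l (idm A ⊗ f)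
  end.

(* A generalized element [x] followed by [f] acting to the right of the objects in [l];
   [x ⟫[l] f ⟫[l'] g] reads a string diagram in order of execution. *)
Definition layer (l : list C) (X Y Z : C) (f : hom X Y) (x : hom Z (in_context l X)) :
  hom Z (in_context l Y) := comp (whisker l f) x.

Lemma whisker_comp l (X Y Z : C) (g : hom Y Z) (f : hom X Y) :
  whisker l (comp g f) = comp (whisker l g) (whisker l f).
Proof.
elim: l X Y Z g f => //= A l IH X Y Z g f.
by rewrite -IH -tensm_comp comp_idl.
Qed.

Lemma whisker_id l (X : C) : whisker l (idm X) = idm _.
Proof. by elim: l X => //= A l IH X; rewrite tensm_id. Qed.

Lemma layer_comp l (X Y Z T : C) (g : hom Y Z) (f : hom X Y) (x : hom T (in_context l X)) :
  layer (comp g f) x = layer (l:=l) g (layer f x).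
Proof. by rewrite /layer whisker_comp comp_assoc. Qed.

Lemma layer_id l (X T : C) (x : hom T (in_context l X)) : layer (idm X) x = x.
Proof. by rewrite /layer whisker_id comp_idl. Qed.

Lemma layer_cons A l (X Y T : C) (f : hom X Y) (x : hom T (in_context (A :: l) X)) :
  layer (l := l) (idm A ⊗ f) x = layer (l := A :: l) f x.
Proof. by []. Qed.

Lemma layer_idid l A (X T : C) (x : hom T (in_context l (A ⊠ X))) :
  layer (l:=l) (idm A ⊗ idm X) x = x.
Proof. by rewrite tensm_id layer_id. Qed.

(** The Yoneda argument: the generic element [idm X] decides. *)
Lemma layer_ext (X Y : C) (f g : hom X Y) :
  (forall Z (x : hom Z (in_context nil X)), layer (l:=nil) f x = layer (l:=nil) g x) -> f = g.
Proof. by move/(_ X (idm X)); rewrite /layer /= !comp_idr. Qed.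

(** The head of the list is the outermost object, whereas for [whisker] it is the nearest one. *)
Fixpoint whisker_word (a : list C) (X Y : C) (g : hom X Y) : hom (right_nest a X) (right_nest a Y) :=
  match a with nil => g | A :: a => idm A ⊗ whisker_word a g end.

Lemma tens_left_nest_from (A B : C) a : A ⊠ left_nest_from B a = left_nest_from (A ⊠ B) a.
Proof. by elim: a B => [|D a IH] B //=; rewrite IH tens_assoc. Qed.

Lemma whisker_word_arrow a (X Y : C) (g : hom X Y) : whisker_word a g ≈ idm (left_nest a) ⊗ g.
Proof.
case: a => [|A a] /=; first by rewrite tensm_unitl.
elim: a A => [|B a IH] A //=; rewrite (tensm_arrow (eq_refl _) (IH B)).
by rewrite tensm_assoc tensm_id tens_left_nest_from.
Qed.

(** The interchange law: both orders of execution are [f ⊗ g] up to [≈]. *)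
Lemma rtens_nat (a b : list C) (f : hom (left_nest a) (left_nest b)) l (X Y Z : C)
    (g : hom X Y) (x : hom Z (in_context l (right_nest a X))) :
  layer (rtens f Y) (layer (whisker_word a g) x) = layer (l := l) (whisker_word b g) (layer (rtens f X) x).
Proof.
rewrite -!layer_comp; congr (layer _ x); apply: arrow_inj.
rewrite (comp_arrow (rtens_arrow f Y) (whisker_word_arrow a g)).
rewrite (comp_arrow (whisker_word_arrow b g) (rtens_arrow f X)).
by rewrite -!tensm_comp !comp_idl !comp_idr.
Qed.

Lemma rtens_id a (X : C) : idm (right_nest a X) ≈ idm (left_nest a) ⊗ X.
Proof. by rewrite tensm_id left_right_nest. Qed.

Lemma rtens_idtens (A B X D : C) (f : hom D D) :
  f ≈ idm B ⊗ X -> idm A ⊗ f ≈ idm (A ⊠ B) ⊗ X.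
Proof. by move=> H; rewrite -tensm_id; apply: rtens_left. Qed.

Lemma eq_arrow (A B : C) (f g : hom A B) : f = g -> f ≈ g.
Proof. by move->. Qed.

(** [F] and [G] are unknown when this is applied: [nest] computes them from [L] and [R], and only
    then is the equation compared with the goal [P]. *)
Lemma transfer_layer (A B A' B' A1 B1 X : C) (L : hom A B) (R : hom A' B')
   (F G : hom A1 B1) (P : Prop) l Z (x : hom Z (in_context l A1)) :
  L ≈ R -> F ≈ L ⊗ X -> G ≈ R ⊗ X ->
  (layer (l:=l) F x = layer (l:=l) G x -> P) -> P.
Proof.
move=> H HF HG; apply; congr (layer _ x); apply: arrow_inj.
exact: transfer HF HG H.
Qed.

End Lifting.

Ltac word A acc :=
  lazymatch A with
  | tens ?A ?B => word A (cons B acc)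
  | unit_obj => acc
  | ?A => constr:(cons A acc)
  end.

Ltac word_of A :=
  let T := type of A in
  let T := lazymatch T with obj ?C => constr:(obj C) end in
  word A (@nil T).

(* Solves [?f ≈ E ⊗ X] with a composite of whiskered [rtens]. *)
Ltac nest :=
  lazymatch goal with
  | |- _ = Arrow (?E ⊗ idm ?X) =>
    lazymatch E with
    | strict_comp _ _ => eapply rtens_comp; [nest | nest]
    | comp _ _ => eapply rtens_comp_typed; [nest | nest]
    | idm unit_obj ⊗ _ => eapply rtens_leftK; nest
    | idm (tens _ _) ⊗ _ => eapply rtens_left2; nest
    | idm _ ⊗ _ => eapply rtens_left; nest
    | _ ⊗ idm unit_obj => eapply rtens_rightK; nest
    | _ ⊗ idm (tens _ _) => eapply rtens_right2; nest
    | _ ⊗ idm _ => eapply rtens_right; nest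
    | _ ⊗ _ => eapply rtens_tens; [nest | nest]
    | idm (tens _ (tens _ _)) => eapply rtens_idtens; nest
    | idm ?A => let a := word_of A in exact (rtens_id a X)
    | _ =>
      lazymatch type of E with
      | hom ?A ?B =>
        let a := word_of A in
        let b := word_of B in
        exact (@rtens_arrow _ a b E X)
      end
    end
  end.

Ltac split_layers := rewrite ?(layer_comp, layer_id, layer_idid, layer_cons).

(** Its failure is the test of independence: two layers are exchanged only if the context of one
    contains all the objects that the other acts on. *)
Ltac prefix l l0 :=
  match l with
  | l0 => lazymatch type of l with list ?T => constr:(@nil T) end
  | cons ?A ?t => let w := prefix t l0 in constr:(cons A w)
  end.

Ltac shallow_step :=
  match goal with
  | |- context T [@layer ?C ?l _ _ ?Z (@rtens _ ?a ?b ?g ?Y) (@layer _ ?l' ?V ?W _ ?f ?x)] =>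
    let l0 := eval cbn [List.rev_append] in (List.rev_append a l) in
    let w := prefix l' l0 in
    let X' := eval cbn [in_context right_nest] in (in_context w V) in
    let l1 := eval cbn [List.rev_append List.app] in (List.app w (List.rev_append b l)) in
    let fw := eval cbn [whisker] in (whisker w f) in
    let E := fresh in
    assert (E : @layer C l _ _ Z (@rtens _ a b g Y) (@layer _ l' V W _ f x) =
                @layer C l1 V W _ f (@layer C l _ _ Z (@rtens _ a b g X') x))
      by exact (@rtens_nat C a b g l X' _ Z fw x);
    rewrite E; clear E
  end.
(* Normal forms for the interchange law: of two independent layers, the one with fewer
   objects on its left is executed first, respectively last. *)
Ltac shallow_first := repeat shallow_step.

Ltac deep_step :=
  match goal with
  | |- context [@layer ?C ?l1 ?V ?W ?Z ?f (@layer _ ?l _ _ _ (@rtens _ ?a ?b ?g ?Y) ?x)] =>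
    let l0 := eval cbn [List.rev_append] in (List.rev_append b l) in
    let w := prefix l1 l0 in
    let X' := eval cbn [in_context right_nest] in (in_context w W) in
    let l' := eval cbn [List.rev_append List.app] in (List.app w (List.rev_append a l)) in
    let fw := eval cbn [whisker] in (whisker w f) in
    let E := fresh in
    assert (E : @layer C l1 V W Z f (@layer C l _ _ Z (@rtens C a b g Y) x) =
                @layer C l _ _ Z (@rtens _ a b g X') (@layer _ l' V W _ f x))
      by exact (eq_sym (@rtens_nat C a b g l _ X' Z fw x));
    rewrite E; clear E
  end.
Ltac deep_first := repeat deep_step.

(** Turns an equation of morphisms into a law on layers in any context; equation and goal are first
    brought to the same interchange normal form. *)
Ltac from_arrows hyp X :=
  lazymatch goal with
  | x : hom ?Z (in_context ?l ?A) |- _ =>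
    let h := lazymatch type of hyp with
             | Arrow _ = _ => constr:(hyp)
             | _ => constr:(eq_arrow hyp)
             end in
    refine (@transfer_layer _ _ _ _ _ _ _ X _ _ _ _ _ l Z x h _ _ _); [nest | nest |];
    split_layers; let E := fresh in
    shallow_first; intros E; revert E; shallow_first; intros E; first [exact E | exact (eq_sym E)]
  end.

Ltac by_layers :=
  lazymatch goal with |- Arrow _ = Arrow _ => idtac | _ => apply: arrow_inj end;
  eapply untransfer; [nest | nest | refine (eq_arrow _)];
  refine (layer_ext _); intros; split_layers.

Notation "x ⟫[ l ] f" := (layer (l := l) f x)
  (at level 50, left associativity, format "x  ⟫[ l ]  f") : cat_scope.

(** * Braidings *)

Section Braiding.
Context (C : strict_braided).

Lemma inverse_arrow (A B A' B' : C) (f : hom A B) (g : hom B A) (f' : hom A' B')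
    (g' : hom B' A') :
  comp g f = idm A -> comp f' g' = idm B' -> f ≈ f' -> g ≈ g'.
Proof.
move=> gf fg' /arrow_cast[eA [eB e]]; subst => /=.
by rewrite -(comp_idr g) -fg' comp_assoc /= gf comp_idl.
Qed.

Notation brd A B :=  (@rtens C [A; B] [B; A] (braid A%C B%C) _).
Notation brdV A B := (@rtens C [B; A] [A; B] (braidV A B) _).

Lemma brdK (A B : C) l X Z (x : hom Z (in_context l (A ⊠ (B ⊠ X)))) :
  x ⟫[l] brd A B ⟫[l] brdV A B = x.
Proof. from_arrows (braidK A B) X. Qed.

Lemma brdVK (A B : C) l X Z (x : hom Z (in_context l (B ⊠ (A ⊠ X)))) :
  x ⟫[l] brdV A B ⟫[l] brd A B = x.
Proof. from_arrows (braidVK A B) X. Qed.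

(** Inverting one hexagon of [c] gives the other hexagon of [c^-1]. Every layer law for [braid] thus
    holds for [braidV] too. *)
Definition rev_braided : strict_braided.
Proof.
refine (@StrictBraided C (fun A B : C => braidV B A) (fun A B : C => braid B A) _ _ _ _ _).
- by move=> A B; apply: braidVK.
- by move=> A B; apply: braidK.
- move=> A A' B B' f g.
  have := braid_nat g f; rewrite /strict_comp /= => nat.
  rewrite -[comp _ (f ⊗ g)]comp_idr -(braidVK B A) /strict_comp /=.
  rewrite -comp_assoc (comp_assoc (f ⊗ g)) -nat !comp_assoc.
  by have := braidK B' A'; rewrite /strict_comp /= => ->; rewrite comp_idl.
- move=> A B D; apply: (inverse_arrow _ _ (braid_hexr B D A)).
  + exact: braidK.
  + by by_layers; rewrite !(brdK, brdVK).
- move=> A B D; apply: (inverse_arrow _ _ (braid_hexl D A B)).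
  + exact: braidK.
  + by by_layers; rewrite !(brdK, brdVK).
Defined.

(** Read as an endomorphism [b] of [E], the braiding is idempotent by the hexagon and has a left
    inverse, hence is the identity. *)
Lemma braid_unitl (E : C) : braid K E ≈ idm E.
Proof.
have b2 := braid_hexr K K E; rewrite tens_unitl in b2.
have [b eb] : exists b : hom E E, b ≈ braid K E.
  by exists (cast_hom (tens_unitl E) (tens_unitr E) (braid K E)); apply: cast_hom_arrow.
have [v ev] : exists v : hom E E, v ≈ braidV K E.
  exists (cast_hom (tens_unitr E) (tens_unitl E) (braidV K E)); exact: cast_hom_arrow.
have vb : comp v b = idm E.
  apply: arrow_inj; rewrite (comp_arrow ev eb).
  have := braidK K E; rewrite /strict_comp /= => ->.
  exact/idm_arrow/tens_unitl.
have bb : b = comp b b.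
  apply: arrow_inj; rewrite eb b2; symmetry; apply: strict_comp_arrow;
    by rewrite ?tensm_unitr ?tensm_unitl.
by rewrite -eb -[b]comp_idl -vb -comp_assoc -bb.
Qed.

Lemma braid_unitr (E : C) : braid E K ≈ idm E.
Proof.
have b2 := braid_hexl E K K; rewrite tens_unitl in b2.
have [b eb] : exists b : hom E E, b ≈ braid E K.
  exists (cast_hom (tens_unitr E) (tens_unitl E) (braid E K)); exact: cast_hom_arrow.
have [v ev] : exists v : hom E E, v ≈ braidV E K.
  exists (cast_hom (tens_unitl E) (tens_unitr E) (braidV E K)); exact: cast_hom_arrow.
have vb : comp v b = idm E.
  apply: arrow_inj; rewrite (comp_arrow ev eb).
  have := braidK E K; rewrite /strict_comp /= => ->.
  exact/idm_arrow/tens_unitr.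
have bb : b = comp b b.
  apply: arrow_inj; rewrite eb b2; symmetry; apply: strict_comp_arrow;
    by rewrite ?tensm_unitr ?tensm_unitl.
by rewrite -eb -[b]comp_idl -vb -comp_assoc -bb.
Qed.

(** Naturality moves [f] through the crossing, and a hexagon splits the crossing with [A ⊠ B]. *)
Lemma braid_mul_l (A B D E : C) (f : hom (A ⊠ B) D) :
  braid D E ∘ (f ⊗ idm E) ≈ (idm E ⊗ f) ∘ ((braid A E ⊗ idm B) ∘ (idm A ⊗ braid B E)).
Proof. by rewrite braid_nat; apply: strict_comp_arrow => //; apply: braid_hexr. Qed.

Lemma braid_mul_r (A B D E : C) (f : hom (A ⊠ B) D) :
  braid E D ∘ (idm E ⊗ f) ≈ (f ⊗ idm E) ∘ ((idm A ⊗ braid E B) ∘ (braid E A ⊗ idm B)).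
Proof. by rewrite braid_nat; apply: strict_comp_arrow => //; apply: braid_hexl. Qed.

Lemma braid_comul_l (A B D E : C) (f : hom D (A ⊠ B)) :
  (idm E ⊗ f) ∘ braid D E ≈ (braid A E ⊗ idm B) ∘ (idm A ⊗ braid B E) ∘ (f ⊗ idm E).
Proof.
rewrite -(braid_nat f (idm E)); apply: strict_comp_arrow => //; apply: braid_hexr.
Qed.

Lemma braid_comul_r (A B D E : C) (f : hom D (A ⊠ B)) :
  (f ⊗ idm E) ∘ braid E D ≈ (idm A ⊗ braid E B) ∘ (braid E A ⊗ idm B) ∘ (idm E ⊗ f).
Proof.
rewrite -(braid_nat (idm E) f); apply: strict_comp_arrow => //; apply: braid_hexl.
Qed.

Lemma braid_unit_l (D E : C) (f : hom K D) :
  braid D E ∘ (f ⊗ idm E) ≈ idm E ⊗ f.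
Proof.
rewrite braid_nat -[RHS](f_equal Arrow (comp_idr _)).
symmetry; apply: strict_comp_arrow => //.
rewrite braid_unitl; apply: idm_arrow; apply: tens_unitr.
Qed.

Lemma braid_counit_l (D E : C) (f : hom D K) :
  (idm E ⊗ f) ∘ braid D E ≈ f ⊗ idm E.
Proof.
rewrite -(braid_nat f (idm E)) -[RHS](f_equal Arrow (comp_idl _)).
symmetry; apply: strict_comp_arrow => //.
rewrite braid_unitl; apply: idm_arrow; apply: tens_unitl.
Qed.

Lemma braid_counit_r (D E : C) (f : hom D K) :
  (f ⊗ idm E) ∘ braid E D ≈ idm E ⊗ f.
Proof.
rewrite -(braid_nat (idm E) f) -[RHS](f_equal Arrow (comp_idl _)).
symmetry; apply: strict_comp_arrow => //.
rewrite braid_unitr; apply: idm_arrow; apply: tens_unitr.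
Qed.

(** Naturality of the braiding with respect to [braid A B] itself, with a hexagon on either side. *)
Lemma braid_yang_baxter (A B E : C) :
  (braid B E ⊗ idm A) ∘ (idm B ⊗ braid A E) ∘ (braid A B ⊗ idm E)
  ≈ (idm E ⊗ braid A B) ∘ ((braid A E ⊗ idm B) ∘ (idm A ⊗ braid B E)).
Proof.
transitivity (Arrow (braid (B ⊠ A) E ∘ (braid A B ⊗ idm E))).
  by symmetry; apply: strict_comp_arrow => //; apply: braid_hexr.
by rewrite braid_nat; apply: strict_comp_arrow => //; apply: braid_hexr.
Qed.

Section BraidLayers.
Context (l : list C) (A B D E X Z : C).

Lemma brd_mul_l (f : hom (A ⊠ B) D) (x : hom Z (in_context l (A ⊠ (B ⊠ (E ⊠ X))))) :
  x ⟫[l] @rtens C [A; B] [D] f _ ⟫[l] brd D E =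
  x ⟫[A :: l] brd B E ⟫[l] brd A E ⟫[E :: l] @rtens C [A; B] [D] f _.
Proof. from_arrows (braid_mul_l E f) X. Qed.

Lemma brd_mul_r (f : hom (A ⊠ B) D) (x : hom Z (in_context l (E ⊠ (A ⊠ (B ⊠ X))))) :
  x ⟫[E :: l] @rtens C [A; B] [D] f _ ⟫[l] brd E D =
  x ⟫[l] brd E A ⟫[A :: l] brd E B ⟫[l] @rtens C [A; B] [D] f _.
Proof. from_arrows (braid_mul_r E f) X. Qed.

Lemma brd_comul_l (f : hom D (A ⊠ B)) (x : hom Z (in_context l (D ⊠ (E ⊠ X)))) :
  x ⟫[l] brd D E ⟫[E :: l] @rtens C [D] [A; B] f _ =
  x ⟫[l] @rtens C [D] [A; B] f _ ⟫[A :: l] brd B E ⟫[l] brd A E.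
Proof. from_arrows (braid_comul_l E f) X. Qed.

Lemma brd_comul_r (f : hom D (A ⊠ B)) (x : hom Z (in_context l (E ⊠ (D ⊠ X)))) :
  x ⟫[l] brd E D ⟫[l] @rtens C [D] [A; B] f _ =
  x ⟫[E :: l] @rtens C [D] [A; B] f _ ⟫[l] brd E A ⟫[A :: l] brd E B.
Proof. from_arrows (braid_comul_r E f) X. Qed.

Lemma brd_unit_l (f : hom K D) (x : hom Z (in_context l (E ⊠ X))) :
  x ⟫[l] @rtens C [] [D] f _ ⟫[l] brd D E = x ⟫[E :: l] @rtens C [] [D] f _.
Proof. from_arrows (braid_unit_l E f) X. Qed.

Lemma brd_counit_l (f : hom D K) (x : hom Z (in_context l (D ⊠ (E ⊠ X)))) :
  x ⟫[l] brd D E ⟫[E :: l] @rtens C [D] [] f _ = x ⟫[l] @rtens C [D] [] f _.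
Proof. from_arrows (braid_counit_l E f) X. Qed.

Lemma brd_counit_r (f : hom D K) (x : hom Z (in_context l (E ⊠ (D ⊠ X)))) :
  x ⟫[l] brd E D ⟫[l] @rtens C [D] [] f _ = x ⟫[E :: l] @rtens C [D] [] f _.
Proof. from_arrows (braid_counit_r E f) X. Qed.

Lemma brd_nat_r (f : hom D A) (x : hom Z (in_context l (E ⊠ (D ⊠ X)))) :
  x ⟫[E :: l] @rtens C [D] [A] f _ ⟫[l] brd E A =  x ⟫[l] brd E D ⟫[l] @rtens C [D] [A] f _.
Proof. from_arrows (braid_nat (idm E) f) X. Qed.

Lemma yang_baxter (x : hom Z (in_context l (A ⊠ (B ⊠ (E ⊠ X))))) :
  x ⟫[l] brd A B ⟫[B :: l] brd A E ⟫[l] brd B E =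
  x ⟫[A :: l] brd B E ⟫[l] brd A E ⟫[E :: l] brd A B.
Proof. from_arrows (braid_yang_baxter A B E) X. Qed.

End BraidLayers.
End Braiding.

(** * Epimorphisms and coequalizers *)

Definition epi (C : category) (A B : C) (e : hom A B) : Prop :=
  forall (D : C) (u v : hom B D), comp u e = comp v e -> u = v.

Lemma epi_arrow (C : category) (A B A' B' : C) (f : hom A B) (g : hom A' B') :
  f ≈ g -> epi f -> epi g.
Proof. by case/arrow_cast=> eA [eB <-]; subst. Qed.

Lemma coequalizer_epi (C : category) (A B Q : C) (f g : hom A B) (p : hom B Q) :
  is_coequalizer f g p -> epi p.
Proof.
move=> [pfg desc] D u v uv.
have [w [_ w_unique]] : exists! w, comp w p = comp v p.
  by apply: desc; rewrite -!comp_assoc pfg.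
by rewrite -(w_unique u uv) (w_unique v eq_refl).
Qed.

(** Indefinite description makes the mediating morphism available as data, to build actions and
    coactions from it. *)
Lemma coequalizer_desc (C : category) (A B Q : C) (f g : hom A B) (p : hom B Q)
    (E : C) (h : hom B E) :
  is_coequalizer f g p -> comp h f = comp h g -> {u : hom Q E | comp u p = h}.
Proof.
move=> [_ desc] hfg; apply: constructive_indefinite_description.
by have [u [up _]] := desc E h hfg; exists u.
Qed.

Lemma choose_inhabited (T : Type) : inhabited T -> T.
Proof.
move=> inh; have [t _] : {t : T | True}; last exact: t.
by apply: constructive_indefinite_description; case: inh => t; exists t.
Qed.

Lemma epi_ext (C : strict_monoidal) (A B D : C) (e : hom A B) (f g : hom B D) :
  epi e ->
  (forall Z (x : hom Z (in_context nil A)),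
    layer (l := nil) f (layer (l := nil) e x) = layer (l := nil) g (layer (l := nil) e x)) ->
  f = g.
Proof.
move=> e_epi fg; apply: e_epi; apply: layer_ext => Z x.
by rewrite !layer_comp.
Qed.

Ltac by_layers_along e :=
  lazymatch goal with |- Arrow _ = Arrow _ => idtac | _ => apply: arrow_inj end;
  eapply untransfer; [nest | nest | refine (eq_arrow _)];
  refine (epi_ext e _); intros; split_layers.

(** * Weak Hopf quasigroups *)

Section WeakHopfQuasigroup.
Context (C : strict_braided) (H : weak_hopf_quasigroup C).

Infix "·:" := (@cons (obj C)) (at level 60, right associativity).

Notation mu := (@rtens C [whq_obj H; whq_obj H] [whq_obj H] μ _).
Notation eta := (@rtens C [] [whq_obj H] η _).
Notation eps := (@rtens C [whq_obj H] [] ε _).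
Notation de := (@rtens C [whq_obj H] [whq_obj H; whq_obj H] δ _).
Notation la := (@rtens C [whq_obj H] [whq_obj H] λ _).
Notation br := (@rtens C [whq_obj H; whq_obj H] [whq_obj H; whq_obj H]
  (braid (whq_obj H) (whq_obj H)) _).
Notation brV := (@rtens C [whq_obj H; whq_obj H] [whq_obj H; whq_obj H]
  (braidV (whq_obj H) (whq_obj H)) _).
Notation tgt := (@rtens C [whq_obj H] [whq_obj H] (target H) _).
Notation src := (@rtens C [whq_obj H] [whq_obj H] (source H) _).
Notation phi M := (@rtens C [hm_obj M; whq_obj H] [hm_obj M] (φ M) _).
Notation rho M := (@rtens C [hm_obj M] [hm_obj M; whq_obj H] (ρ M) _).
Notation phia M := (@rtens C [hm_obj M; whq_obj H] [hm_obj M] (φα M) _).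
Notation qq M := (@rtens C [hm_obj M] [hm_obj M] (q M) _).

(** * The axioms of [H] as laws on layers *)

Lemma mu_unitr l X Z (x : hom Z (in_context l (H ⊠ X))) :
  x ⟫[H ·: l] eta ⟫[l] mu = x.
Proof. from_arrows (magma_unitr (whq_magma H)) X. Qed.

Lemma mu_unitl l X Z (x : hom Z (in_context l (H ⊠ X))) :
  x ⟫[l] eta ⟫[l] mu = x.
Proof. from_arrows (magma_unitl (whq_magma H)) X. Qed.

Lemma de_counitr l X Z (x : hom Z (in_context l (H ⊠ X))) :
  x ⟫[l] de ⟫[H ·: l] eps = x.
Proof. from_arrows (comonoid_counitr (whq_comonoid H)) X. Qed.

Lemma de_counitl l X Z (x : hom Z (in_context l (H ⊠ X))) :
  x ⟫[l] de ⟫[l] eps = x.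
Proof. from_arrows (comonoid_counitl (whq_comonoid H)) X. Qed.

Lemma de_coassoc l X Z (x : hom Z (in_context l (H ⊠ X))) :
  x ⟫[l] de ⟫[l] de = x ⟫[l] de ⟫[H ·: l] de.
Proof. from_arrows (comonoid_coassoc (whq_comonoid H)) X. Qed.

Lemma de_mul l X Z (x : hom Z (in_context l (H ⊠ (H ⊠ X)))) :
  x ⟫[l] mu ⟫[l] de =
  x ⟫[l] de ⟫[H ·: H ·: l] de ⟫[H ·: l] br ⟫[l] mu ⟫[H ·: l] mu.
Proof. from_arrows (whq_comul_mul H) X. Qed.

Lemma eps_assoc l X Z (x : hom Z (in_context l (H ⊠ (H ⊠ (H ⊠ X))))) :
  x ⟫[l] mu ⟫[l] mu ⟫[l] eps = x ⟫[H ·: l] mu ⟫[l] mu ⟫[l] eps.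
Proof. from_arrows (whq_counit_assoc H) X. Qed.

Lemma eps_mul l X Z (x : hom Z (in_context l (H ⊠ (H ⊠ (H ⊠ X))))) :
  x ⟫[H ·: l] mu ⟫[l] mu ⟫[l] eps
  = x ⟫[H ·: l] de ⟫[l] mu ⟫[l] eps ⟫[l] mu ⟫[l] eps.
Proof. from_arrows (whq_counit_mul H) X. Qed.

Lemma eps_mulV l X Z (x : hom Z (in_context l (H ⊠ (H ⊠ (H ⊠ X))))) :
  x ⟫[H ·: l] mu ⟫[l] mu ⟫[l] eps
  = x ⟫[H ·: l] de ⟫[H ·: l] brV ⟫[l] mu ⟫[l] eps ⟫[l] mu ⟫[l] eps.
Proof. from_arrows (whq_counit_mulV H) X. Qed.

Lemma de_unit l X Z (x : hom Z (in_context l X)) :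
  x ⟫[l] eta ⟫[l] de ⟫[l] de
  = x ⟫[l] eta ⟫[l] de ⟫[H ·: H ·: l] eta ⟫[H ·: H ·: l] de ⟫[H ·: l] mu.
Proof. from_arrows (whq_comul_unit H) X. Qed.

Lemma tgtE l X Z (x : hom Z (in_context l (H ⊠ X))) :
  x ⟫[l] tgt = x ⟫[l] de ⟫[H ·: l] la ⟫[l] mu.
Proof.
have E : target H = μ ∘ (idm H ⊗ λ) ∘ δ by [].
from_arrows E X.
Qed.

Lemma tgt_eps l X Z (x : hom Z (in_context l (H ⊠ X))) :
  x ⟫[l] tgt = x ⟫[l] eta ⟫[l] de ⟫[H ·: l] br ⟫[l] mu ⟫[l] eps.
Proof.
have E := antipode_target (whq_antipode H).
rewrite -[convolution δ _ _ _]/(target H) in E.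
from_arrows E X.
Qed.

Lemma src_eps l X Z (x : hom Z (in_context l (H ⊠ X))) :
  x ⟫[l] src = x ⟫[H ·: l] eta ⟫[H ·: l] de ⟫[l] br ⟫[H ·: l] mu ⟫[H ·: l] eps.
Proof.
have E := antipode_source (whq_antipode H).
rewrite -[convolution δ _ _ _]/(source H) in E.
from_arrows E X.
Qed.

Lemma la_mulK l X Z (x : hom Z (in_context l (H ⊠ (H ⊠ X)))) :
  x ⟫[l] de ⟫[H ·: l] mu ⟫[l] la ⟫[l] mu = x ⟫[l] src ⟫[l] mu.
Proof.
have E := antipode_mulVK (whq_antipode H).
rewrite -[convolution δ _ _ _]/(source H) in E.
from_arrows E X.
Qed.

Lemma mul_laK l X Z (x : hom Z (in_context l (H ⊠ (H ⊠ X)))) :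
  x ⟫[H ·: l] de ⟫[l] mu ⟫[H ·: l] la ⟫[l] mu = x ⟫[H ·: l] tgt ⟫[l] mu.
Proof.
have E := antipode_mulK (whq_antipode H).
rewrite -[convolution δ _ _ _]/(target H) in E.
from_arrows E X.
Qed.

Lemma mul_laVK l X Z (x : hom Z (in_context l (H ⊠ (H ⊠ X)))) :
  x ⟫[H ·: l] de ⟫[H ·: l] la ⟫[l] mu ⟫[l] mu = x ⟫[H ·: l] src ⟫[l] mu.
Proof.
have E := antipode_mulVKr (whq_antipode H).
rewrite -[convolution δ _ _ _]/(source H) in E.
from_arrows E X.
Qed.

(* Used for [(δ, c)] and for [(c^-1 ∘ δ, c^-1)]: the latter turns the conditions on
   [ε ∘ μ] that involve [c^-1] into the former. *)
Section Counital.
Context (d0 : hom H (H ⊠ H)) (s0 : hom (H ⊠ H) (H ⊠ H)).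
Notation d := (@rtens C [whq_obj H] [whq_obj H; whq_obj H] d0 _).
Notation s := (@rtens C [whq_obj H; whq_obj H] [whq_obj H; whq_obj H] s0 _).
Context (d_mul : forall l X Z (x : hom Z (in_context l (H ⊠ (H ⊠ X)))),
  x ⟫[l] mu ⟫[l] d =
  x ⟫[l] d ⟫[H ·: H ·: l] d ⟫[H ·: l] s ⟫[l] mu ⟫[H ·: l] mu).
Context (d_counitl : forall l X Z (x : hom Z (in_context l (H ⊠ X))),
  x ⟫[l] d ⟫[l] eps = x).
Context (d_counitr : forall l X Z (x : hom Z (in_context l (H ⊠ X))),
  x ⟫[l] d ⟫[H ·: l] eps = x).
Context (d_coassoc : forall l X Z (x : hom Z (in_context l (H ⊠ X))),
  x ⟫[l] d ⟫[l] d = x ⟫[l] d ⟫[H ·: l] d).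
Context (eps_d : forall l X Z (x : hom Z (in_context l (H ⊠ (H ⊠ (H ⊠ X))))),
  x ⟫[H ·: l] mu ⟫[l] mu ⟫[l] eps
  = x ⟫[H ·: l] d ⟫[l] mu ⟫[l] eps ⟫[l] mu ⟫[l] eps).

(** On the right, write [k] as [1 k], expand its coproduct and split [ε(h (1_1 k1))] at [1_1]; what
    remains beside [ε(h 1_1)] is [1_2 k] with a counit applied to one leg. *)
Lemma counital_mul_l l X Z (x : hom Z (in_context l (H ⊠ (H ⊠ X)))) :
  x ⟫[H ·: l] eta ⟫[H ·: l] d ⟫[l] mu ⟫[l] eps ⟫[l] mu =
  x ⟫[H ·: l] d ⟫[l] mu ⟫[l] eps.
Proof.
rewrite -[in RHS](mu_unitl (l := H ·: l) x) d_mul; shallow_first.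
rewrite eps_d; shallow_first; rewrite d_coassoc; shallow_first.
by rewrite -[LHS]d_counitl d_mul; shallow_first.
Qed.

(** The mirror image, starting from [h = h 1]. *)
Lemma counital_mul_r l X Z (x : hom Z (in_context l (H ⊠ (H ⊠ X)))) :
  x ⟫[H ·: l] eta ⟫[H ·: l] d ⟫[H ·: H ·: l] mu ⟫[H ·: H ·: l] eps ⟫[l] mu =
  x ⟫[l] d ⟫[H ·: l] mu ⟫[H ·: l] eps.
Proof.
rewrite -[in RHS](mu_unitr (l := l) x) d_mul; shallow_first.
rewrite eps_assoc eps_d; deep_first; rewrite -d_coassoc; shallow_first.
by rewrite -[LHS]d_counitr; shallow_first; rewrite d_mul; shallow_first.
Qed.

End Counital.

(** * The inverse braiding and the comultiplication [c^-1 ∘ δ] *)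

Lemma brK l X Z (x : hom Z (in_context l (H ⊠ (H ⊠ X)))) : x ⟫[l] br ⟫[l] brV = x.
Proof. exact: brdK. Qed.

Lemma brVK l X Z (x : hom Z (in_context l (H ⊠ (H ⊠ X)))) : x ⟫[l] brV ⟫[l] br = x.
Proof. exact: brdVK. Qed.

Lemma brV_mul_l l X Z (x : hom Z (in_context l (H ⊠ (H ⊠ (H ⊠ X))))) :
  x ⟫[l] mu ⟫[l] brV = x ⟫[H ·: l] brV ⟫[l] brV ⟫[H ·: l] mu.
Proof. exact: (@brd_mul_l (rev_braided C)). Qed.

Lemma brV_mul_r l X Z (x : hom Z (in_context l (H ⊠ (H ⊠ (H ⊠ X))))) :
  x ⟫[H ·: l] mu ⟫[l] brV = x ⟫[l] brV ⟫[H ·: l] brV ⟫[l] mu.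
Proof. exact: (@brd_mul_r (rev_braided C)). Qed.

Lemma brV_comul_l l X Z (x : hom Z (in_context l (H ⊠ (H ⊠ X)))) :
  x ⟫[l] brV ⟫[H ·: l] de = x ⟫[l] de ⟫[H ·: l] brV ⟫[l] brV.
Proof. exact: (@brd_comul_l (rev_braided C)). Qed.

Lemma brV_comul_r l X Z (x : hom Z (in_context l (H ⊠ (H ⊠ X)))) :
  x ⟫[l] brV ⟫[l] de = x ⟫[H ·: l] de ⟫[l] brV ⟫[H ·: l] brV.
Proof. exact: (@brd_comul_r (rev_braided C)). Qed.

Lemma brV_counit_l l X Z (x : hom Z (in_context l (H ⊠ (H ⊠ X)))) :
  x ⟫[l] brV ⟫[H ·: l] eps = x ⟫[l] eps.
Proof. exact: (@brd_counit_l (rev_braided C)). Qed.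

Lemma brV_counit_r l X Z (x : hom Z (in_context l (H ⊠ (H ⊠ X)))) :
  x ⟫[l] brV ⟫[l] eps = x ⟫[H ·: l] eps.
Proof. exact: (@brd_counit_r (rev_braided C)). Qed.

Lemma brV_yb l X Z (x : hom Z (in_context l (H ⊠ (H ⊠ (H ⊠ X))))) :
  x ⟫[l] brV ⟫[H ·: l] brV ⟫[l] brV = x ⟫[H ·: l] brV ⟫[l] brV ⟫[H ·: l] brV.
Proof. exact: (@yang_baxter (rev_braided C)). Qed.

Definition deV : hom H (H ⊠ H) := braidV H H ∘ δ.
Notation dV := (@rtens C [whq_obj H] [whq_obj H; whq_obj H] deV _).

Lemma dVE l X Z (x : hom Z (in_context l (H ⊠ X))) : x ⟫[l] dV = x ⟫[l] de ⟫[l] brV.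
Proof.
have E : deV = braidV H H ∘ δ by [].
from_arrows E X.
Qed.

Lemma dV_mul l X Z (x : hom Z (in_context l (H ⊠ (H ⊠ X)))) :
  x ⟫[l] mu ⟫[l] dV =
  x ⟫[l] dV ⟫[H ·: H ·: l] dV ⟫[H ·: l] brV ⟫[l] mu ⟫[H ·: l] mu.
Proof.
rewrite !dVE de_mul brV_mul_r brV_mul_l brK; shallow_first.
by rewrite brV_mul_l; shallow_first.
Qed.

Lemma dV_counitl l X Z (x : hom Z (in_context l (H ⊠ X))) : x ⟫[l] dV ⟫[l] eps = x.
Proof. by rewrite dVE brV_counit_r de_counitr. Qed.

Lemma dV_counitr l X Z (x : hom Z (in_context l (H ⊠ X))) : x ⟫[l] dV ⟫[H ·: l] eps = x.
Proof. by rewrite dVE brV_counit_l de_counitl. Qed.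

Lemma dV_coassoc l X Z (x : hom Z (in_context l (H ⊠ X))) :
  x ⟫[l] dV ⟫[l] dV = x ⟫[l] dV ⟫[H ·: l] dV.
Proof. by rewrite !dVE brV_comul_r brV_comul_l -de_coassoc brV_yb. Qed.

Lemma eps_dV l X Z (x : hom Z (in_context l (H ⊠ (H ⊠ (H ⊠ X))))) :
  x ⟫[H ·: l] mu ⟫[l] mu ⟫[l] eps
  = x ⟫[H ·: l] dV ⟫[l] mu ⟫[l] eps ⟫[l] mu ⟫[l] eps.
Proof. by rewrite eps_mulV dVE. Qed.

(** After inserting [c^-1] and [c], the crossing strand slides past the whole of [ε ∘ μ], where its
    crossing vanishes as the codomain is [K]. This rewrites [Π] with [c^-1 ∘ δ]. *)
Lemma br_eps_l l X Z (x : hom Z (in_context l (H ⊠ (H ⊠ (H ⊠ X))))) :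
  x ⟫[H ·: l] br ⟫[l] mu ⟫[l] eps = x ⟫[l] brV ⟫[H ·: l] mu ⟫[H ·: l] eps.
Proof.
by rewrite -[in LHS](brVK x) -brd_mul_r brd_counit_r.
Qed.

Lemma br_eps_r l X Z (x : hom Z (in_context l (H ⊠ (H ⊠ (H ⊠ X))))) :
  x ⟫[l] br ⟫[H ·: l] mu ⟫[H ·: l] eps = x ⟫[H ·: l] brV ⟫[l] mu ⟫[l] eps.
Proof.
by rewrite -[in LHS](brVK (l := H ·: l) x) -brd_mul_l brd_counit_l.
Qed.

Lemma tgtVE l X Z (x : hom Z (in_context l (H ⊠ X))) :
  x ⟫[l] tgt = x ⟫[l] eta ⟫[l] dV ⟫[H ·: l] mu ⟫[H ·: l] eps.
Proof. by rewrite tgt_eps br_eps_l dVE. Qed.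

Lemma srcVE l X Z (x : hom Z (in_context l (H ⊠ X))) :
  x ⟫[l] src = x ⟫[H ·: l] eta ⟫[H ·: l] dV ⟫[l] mu ⟫[l] eps.
Proof. by rewrite src_eps br_eps_r dVE. Qed.

(* [h Π(k) = ε(h1 k) h2] *)
Lemma mul_tgt l X Z (x : hom Z (in_context l (H ⊠ (H ⊠ X)))) :
  x ⟫[H ·: l] tgt ⟫[l] mu = x ⟫[l] de ⟫[H ·: l] br ⟫[l] mu ⟫[l] eps.
Proof.
rewrite tgtVE br_eps_l -dVE.
exact: (counital_mul_r dV_mul dV_counitr dV_coassoc eps_dV).
Qed.

Lemma src_mul l X Z (x : hom Z (in_context l (H ⊠ (H ⊠ X)))) :
  x ⟫[l] src ⟫[l] mu = x ⟫[H ·: l] de ⟫[l] br ⟫[H ·: l] mu ⟫[H ·: l] eps.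
Proof.
rewrite srcVE br_eps_r -dVE.
exact: (counital_mul_l dV_mul dV_counitl dV_coassoc eps_dV).
Qed.

(** In [Π(h) = ε(1_1 h) 1_2] the coproduct of [1_2] creates the iterated coproduct of the unit,
    which [de_unit] factors through two copies of [δ(1)]. *)
Lemma tgt_de l X Z (x : hom Z (in_context l (H ⊠ X))) :
  x ⟫[l] tgt ⟫[l] de = x ⟫[l] tgt ⟫[H ·: l] eta ⟫[H ·: l] de ⟫[l] mu.
Proof.
rewrite tgt_eps; deep_first; rewrite brd_comul_l -de_coassoc de_unit.
deep_first; rewrite brd_mul_l; deep_first; rewrite -brd_comul_l brd_unit_l.
by shallow_first.
Qed.

Lemma tgt_counital l X Z (x : hom Z (in_context l (H ⊠ X))) :
  x ⟫[l] tgt = x ⟫[l] tgt ⟫[H ·: l] eta ⟫[H ·: l] de ⟫[l] mu ⟫[l] eps.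
Proof. by rewrite -tgt_de de_counitl. Qed.

Lemma de_unit_counital l X Z (x : hom Z (in_context l X)) :
  x ⟫[l] eta ⟫[l] de = x ⟫[l] eta ⟫[l] de
   ⟫[H ·: H ·: l] eta ⟫[H ·: H ·: l] de ⟫[H ·: l] mu ⟫[H ·: l] eps.
Proof. by rewrite -de_unit de_coassoc de_counitl. Qed.

(** [Π(h) = ε(Π(h) 1_1) 1_2], and [counital_mul_l] replaces the coproduct of the unit by that of
    [k]. *)
Lemma tgt_mul_eps l X Z (x : hom Z (in_context l (H ⊠ (H ⊠ X)))) :
  x ⟫[l] tgt ⟫[l] mu = x ⟫[H ·: l] de ⟫[l] tgt ⟫[l] mu ⟫[l] eps.
Proof.
rewrite [in LHS]tgt_counital (counital_mul_l de_mul de_counitl de_coassoc eps_mul).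
by shallow_first.
Qed.

Lemma tgt_mul_de l X Z (x : hom Z (in_context l (H ⊠ (H ⊠ X)))) :
  x ⟫[l] tgt ⟫[l] mu ⟫[l] de = x ⟫[l] tgt ⟫[H ·: l] de ⟫[l] mu.
Proof.
rewrite tgt_mul_eps; deep_first; rewrite -de_coassoc.
by rewrite -tgt_mul_eps; shallow_first.
Qed.

(** With [y = Π(h)], the two sides are [ε((y k1) u1) k2 u2] and [ε(y (k1 u1)) k2 u2], equal because
    [ε ∘ μ] is associative. *)
Lemma tgt_mul_assoc l X Z (x : hom Z (in_context l (H ⊠ (H ⊠ (H ⊠ X))))) :
  x ⟫[l] tgt ⟫[l] mu ⟫[l] mu = x ⟫[l] tgt ⟫[H ·: l] mu ⟫[l] mu.
Proof.
rewrite -[LHS]de_counitl de_mul tgt_mul_de; deep_first; rewrite eps_assoc.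
rewrite [in RHS]tgt_mul_eps de_mul.
by shallow_first.
Qed.

(** For [y = Π(h)], [δ(y k) = y k1 ⊗ k2] gives [Π(y k) = (y k1) λ(k2) = y Π(k)]. *)
Lemma tgt_mul_tgt l X Z (x : hom Z (in_context l (H ⊠ (H ⊠ X)))) :
  x ⟫[l] tgt ⟫[l] mu ⟫[l] tgt = x ⟫[l] tgt ⟫[H ·: l] tgt ⟫[l] mu.
Proof. by rewrite tgtE tgt_mul_de mul_laK. Qed.

Lemma tgt_unit l X Z (x : hom Z (in_context l X)) :
  x ⟫[l] eta ⟫[l] tgt = x ⟫[l] eta.
Proof.
by rewrite tgtVE; shallow_first; rewrite mu_unitr dV_counitr.
Qed.

Lemma src_mulr l X Z (x : hom Z (in_context l (H ⊠ X))) :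
  x ⟫[l] de ⟫[H ·: l] src ⟫[l] mu = x.
Proof.
by rewrite -[RHS](mu_unitr x) -[RHS]de_counitr de_mul src_eps; shallow_first.
Qed.

(* [(h k)_1 ε((h k)_2 u) = (h k1) ε(k2 u)] *)
Lemma mul_de_eps l X Z (x : hom Z (in_context l (H ⊠ (H ⊠ (H ⊠ X))))) :
  x ⟫[l] mu ⟫[l] de ⟫[H ·: l] mu ⟫[H ·: l] eps
  = x ⟫[H ·: l] de ⟫[l] mu ⟫[H ·: l] mu ⟫[H ·: l] eps.
Proof.
rewrite -[in RHS](de_counitr (l := l) (_ ⟫[_] mu)) !de_mul; shallow_first.
rewrite eps_assoc eps_mul; deep_first.
by rewrite -de_coassoc; shallow_first.
Qed.

(** This is [src_mulr] for the product [h k]: the source is expressed through [ε], so [mul_de_eps]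
    moves the coproduct onto [k]. *)
Lemma mul_src l X Z (x : hom Z (in_context l (H ⊠ (H ⊠ X)))) :
  x ⟫[H ·: l] de ⟫[l] mu ⟫[H ·: l] src ⟫[l] mu = x ⟫[l] mu.
Proof.
rewrite -[RHS]src_mulr !srcVE; deep_first.
rewrite mul_de_eps.
by shallow_first.
Qed.

(** Expanding [h Π(k1)] gives [((h k1) λ(k2)) k3], and the last two factors combine into the source
    of [k2]. *)
Lemma mul_tgtK l X Z (x : hom Z (in_context l (H ⊠ (H ⊠ X)))) :
  x ⟫[H ·: l] de ⟫[H ·: l] tgt ⟫[l] mu ⟫[l] mu = x ⟫[l] mu.
Proof.
rewrite -mul_laK -[RHS]mul_src -mul_laVK; shallow_first.
by rewrite de_coassoc; shallow_first.
Qed.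

Lemma tgt_mulK l X Z (x : hom Z (in_context l (H ⊠ X))) :
  x ⟫[l] de ⟫[l] tgt ⟫[l] mu = x.
Proof.
by rewrite -[RHS]mu_unitl -[RHS]mul_tgtK; deep_first; rewrite mu_unitl.
Qed.

Lemma mul_tgt_de l X Z (x : hom Z (in_context l (H ⊠ (H ⊠ X)))) :
  x ⟫[H ·: l] tgt ⟫[l] mu ⟫[l] de
  = x ⟫[l] de ⟫[H ·: l] br ⟫[H ·: l] tgt ⟫[l] mu.
Proof.
rewrite !mul_tgt; deep_first; rewrite brd_comul_l; shallow_first.
by rewrite de_coassoc; shallow_first.
Qed.

(** The sides become [ε((h1 Π(k)) u) h2] and [ε(h1 (Π(k) u)) h2], again equal by associativity of
    [ε ∘ μ]. *)
Lemma mul_tgt_tgt l X Z (x : hom Z (in_context l (H ⊠ (H ⊠ (H ⊠ X))))) :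
  x ⟫[H ·: H ·: l] tgt ⟫[H ·: l] tgt ⟫[l] mu ⟫[l] mu
  = x ⟫[H ·: l] tgt ⟫[H ·: H ·: l] tgt ⟫[H ·: l] mu ⟫[l] mu.
Proof.
rewrite -[in RHS]tgt_mul_tgt [in RHS]mul_tgt; shallow_first.
rewrite brd_mul_r brd_nat_r mul_tgt mul_tgt_de; deep_first; rewrite eps_assoc.
by shallow_first.
Qed.

(** [mul_tgtK] brings in [Π(u1)] in front of [u2] on both sides, which reduces the claim to
    [mul_tgt_tgt]. *)
Lemma mul_tgt_assoc l X Z (x : hom Z (in_context l (H ⊠ (H ⊠ (H ⊠ X))))) :
  x ⟫[H ·: l] tgt ⟫[l] mu ⟫[l] mu = x ⟫[H ·: l] tgt ⟫[H ·: l] mu ⟫[l] mu.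
Proof.
rewrite -[LHS]mul_tgtK -[RHS]mul_tgtK tgt_mul_de; deep_first.
by rewrite tgt_mul_tgt mul_tgt_tgt; shallow_first.
Qed.

(* [λ(h2)_1 ⊗ h1 λ(h2)_2 = λ(h1) Π(h2)_1 ⊗ Π(h2)_2]: replace [Π(h2)] on the right by
   [h2 λ(h3)], cancel [λ(h1)] against it and absorb the resulting [λ(h1) h2]. *)
Lemma comul_la l X Z (x : hom Z (in_context l (H ⊠ X))) :
  x ⟫[l] de ⟫[H ·: l] la ⟫[H ·: l] de ⟫[l] br ⟫[H ·: l] mu
  = x ⟫[l] de ⟫[l] la ⟫[H ·: l] tgt ⟫[H ·: l] de ⟫[l] mu.
Proof.
rewrite -[LHS](de_counitl (l := H ·: l)) de_mul brd_comul_l; shallow_first.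
rewrite [in RHS]tgtE de_mul; shallow_first.
rewrite [in RHS](de_coassoc (l := H ·: l)); deep_first.
rewrite -[in RHS](de_coassoc (l := l)); deep_first; rewrite la_mulK src_mul; shallow_first.
by rewrite brd_comul_r !de_coassoc; deep_first.
Qed.

(** By [comul_la] and [tgt_de] the second leg is that of [δ(1)], which [h ↦ ε(h 1_1) 1_2] fixes. *)
Lemma comul_la_counital l X Z (x : hom Z (in_context l (H ⊠ X))) :
  x ⟫[l] de ⟫[H ·: l] la ⟫[H ·: l] de ⟫[l] br ⟫[H ·: l] mu
  = x ⟫[l] de ⟫[H ·: l] la ⟫[H ·: l] de ⟫[l] br ⟫[H ·: l] mu
    ⟫[H ·: H ·: l] eta ⟫[H ·: H ·: l] de ⟫[H ·: l] mu ⟫[H ·: l] eps.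
Proof. by rewrite comul_la tgt_de [in LHS]de_unit_counital; shallow_first. Qed.

Lemma counital_br l X Z (x : hom Z (in_context l (H ⊠ (H ⊠ X)))) :
  x ⟫[H ·: l] eta ⟫[H ·: l] de ⟫[l] mu ⟫[l] eps ⟫[l] br
  = x ⟫[l] br ⟫[H ·: H ·: l] eta ⟫[H ·: H ·: l] de ⟫[H ·: l] mu ⟫[H ·: l] eps.
Proof.
deep_first; rewrite -(brd_unit_l (l := H ·: l)); deep_first.
by rewrite brd_comul_l -[in RHS]brd_mul_l brd_counit_l; shallow_first.
Qed.

Lemma counital_mul l X Z (x : hom Z (in_context l (H ⊠ (H ⊠ X)))) :
  x ⟫[H ·: l] eta ⟫[H ·: l] de ⟫[l] mu ⟫[l] eps ⟫[l] mu =
  x ⟫[H ·: l] de ⟫[l] mu ⟫[l] eps.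
Proof. exact: (counital_mul_l de_mul de_counitl de_coassoc eps_mul). Qed.

(** * Hopf modules *)

Section HopfModule.
Context (M : hopf_module H).

Lemma rho_counit l X Z (x : hom Z (in_context l (M ⊠ X))) :
  x ⟫[l] rho M ⟫[M ·: l] eps = x.
Proof. from_arrows (comodule_counit (hm_comodule M)) X. Qed.

Lemma rho_coassoc l X Z (x : hom Z (in_context l (M ⊠ X))) :
  x ⟫[l] rho M ⟫[l] rho M = x ⟫[l] rho M ⟫[M ·: l] de.
Proof. from_arrows (comodule_coassoc (hm_comodule M)) X. Qed.

Lemma phi_unit l X Z (x : hom Z (in_context l (M ⊠ X))) :
  x ⟫[M ·: l] eta ⟫[l] phi M = x.
Proof. from_arrows (hm_unit M) X. Qed.

Lemma rho_phi l X Z (x : hom Z (in_context l (M ⊠ (H ⊠ X)))) :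
  x ⟫[l] phi M ⟫[l] rho M =
  x ⟫[l] rho M ⟫[H ·: M ·: l] de ⟫[M ·: l] br ⟫[l] phi M ⟫[M ·: l] mu.
Proof. from_arrows (hm_coact_act M) X. Qed.

Lemma phi_laK l X Z (x : hom Z (in_context l (M ⊠ (H ⊠ X)))) :
  x ⟫[M ·: l] de ⟫[l] phi M ⟫[M ·: l] la ⟫[l] phi M = x ⟫[M ·: l] tgt ⟫[l] phi M.
Proof. from_arrows (hm_actK M) X. Qed.

Lemma phi_laVK l X Z (x : hom Z (in_context l (M ⊠ (H ⊠ X)))) :
  x ⟫[M ·: l] de ⟫[M ·: l] la ⟫[l] phi M ⟫[l] phi M = x ⟫[M ·: l] src ⟫[l] phi M.
Proof. from_arrows (hm_actVK M) X. Qed.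

Lemma qE l X Z (x : hom Z (in_context l (M ⊠ X))) :
  x ⟫[l] qq M = x ⟫[l] rho M ⟫[M ·: l] la ⟫[l] phi M.
Proof.
have E : q M = φ M ∘ (idm M ⊗ λ) ∘ ρ M by [].
from_arrows E X.
Qed.

Lemma phiaE l X Z (x : hom Z (in_context l (M ⊠ (H ⊠ X)))) :
  x ⟫[l] phia M = x ⟫[l] rho M ⟫[l] qq M ⟫[M ·: l] mu ⟫[l] phi M.
Proof.
have E : φα M = φ M ∘ (q M ⊗ μ) ∘ (ρ M ⊗ idm H) by [].
from_arrows E X.
Qed.

(* The second leg of [ρ(q(m))] is fixed by [h ↦ ε(h 1_1) 1_2]. *)
Lemma q_rho_counital l X Z (x : hom Z (in_context l (M ⊠ X))) :
  x ⟫[l] qq M ⟫[l] rho M =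
  x ⟫[l] qq M ⟫[l] rho M
    ⟫[H ·: M ·: l] eta ⟫[H ·: M ·: l] de ⟫[M ·: l] mu ⟫[M ·: l] eps.
Proof.
rewrite qE rho_phi; shallow_first; rewrite rho_coassoc; deep_first.
by rewrite comul_la_counital; shallow_first.
Qed.

(* [ρ(q(m) h) = q(m) h1 ⊗ h2] *)
Lemma rho_phi_q l X Z (x : hom Z (in_context l (M ⊠ (H ⊠ X)))) :
  x ⟫[l] qq M ⟫[l] phi M ⟫[l] rho M = x ⟫[l] qq M ⟫[M ·: l] de ⟫[l] phi M.
Proof.
rewrite -[in RHS](rho_counit (_ ⟫[_] phi M)) !rho_phi; deep_first.
(* With [m' = q(m)], the leg [m'_1 h2] becomes [ε(m'_1 1_1) 1_2 h2 = ε(m'_1 h2) h3], as produced by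
   the counit inserted on the right. *)
rewrite [in LHS]q_rho_counital counital_br; shallow_first.
rewrite counital_mul; deep_first.
by rewrite de_coassoc.
Qed.

Lemma rho_src l X Z (x : hom Z (in_context l (M ⊠ X))) :
  x ⟫[l] rho M ⟫[M ·: l] src ⟫[l] phi M = x.
Proof.
by rewrite -[RHS]phi_unit -[RHS]rho_counit rho_phi src_eps; shallow_first.
Qed.

Lemma rho_q_phi l X Z (x : hom Z (in_context l (M ⊠ X))) :
  x ⟫[l] rho M ⟫[l] qq M ⟫[l] phi M = x.
Proof. by rewrite qE rho_coassoc phi_laVK rho_src. Qed.

(** Expresses [q] through [ρ] and [φα], the operations that morphisms respect: [q(m_0) (m_1 λ(m_2))
    = (q(m_0) m_1) λ(m_2) = m_0 λ(m_1)]. *)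
Lemma phia_la l X Z (x : hom Z (in_context l (M ⊠ X))) :
  x ⟫[l] rho M ⟫[M ·: l] la ⟫[l] phia M = x ⟫[l] qq M.
Proof.
rewrite phiaE; shallow_first; rewrite rho_coassoc; deep_first;
  rewrite -tgtE; shallow_first.
rewrite -phi_laK; deep_first; rewrite -rho_coassoc; shallow_first.
by rewrite rho_q_phi -qE.
Qed.

Lemma q_phi_q l X Z (x : hom Z (in_context l (M ⊠ (H ⊠ X)))) :
  x ⟫[l] qq M ⟫[l] phi M ⟫[l] qq M = x ⟫[l] qq M ⟫[M ·: l] tgt ⟫[l] phi M.
Proof. by rewrite [X in X = _]qE rho_phi_q phi_laK. Qed.

Lemma qK l X Z (x : hom Z (in_context l (M ⊠ X))) :
  x ⟫[l] qq M ⟫[l] qq M = x ⟫[l] qq M.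
Proof.
(* The case [h = 1]. *)
have := q_phi_q (x ⟫[M ·: l] eta); shallow_first.
by rewrite tgt_unit !phi_unit.
Qed.

Context (phi_strong : forall l X Z (x : hom Z (in_context l (M ⊠ (H ⊠ (H ⊠ X))))),
  x ⟫[M ·: l] tgt ⟫[l] phi M ⟫[l] phi M = x ⟫[M ·: l] tgt ⟫[M ·: l] mu ⟫[l] phi M).

(** The left side is [(q(m) Π(h1)) (h2 k)]; strength moves the bracket, and [Π(h1) h2] collapses to
    [h]. *)
Lemma q_phi_phia l X Z (x : hom Z (in_context l (M ⊠ (H ⊠ (H ⊠ X))))) :
  x ⟫[l] qq M ⟫[l] phi M ⟫[l] phia M = x ⟫[l] qq M ⟫[M ·: l] mu ⟫[l] phi M.
Proof.
rewrite phiaE rho_phi_q; deep_first; rewrite q_phi_q phi_strong; shallow_first.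
by rewrite -tgt_mul_assoc tgt_mulK.
Qed.

Lemma q_phia l X Z (x : hom Z (in_context l (M ⊠ (H ⊠ X)))) :
  x ⟫[l] qq M ⟫[l] phia M = x ⟫[l] qq M ⟫[l] phi M.
Proof.
have := q_phi_phia (x ⟫[M ·: l] eta); shallow_first.
by rewrite phi_unit mu_unitl.
Qed.

End HopfModule.

(** * The equivalence *)

Section Equivalence.
Context (HL : splitting (target H)).

Notation iL := (@rtens C [img HL] [whq_obj H] (incl HL) _).
Notation pL := (@rtens C [whq_obj H] [img HL] (proj HL) _).
Notation modules := (right_module (η_L HL) (μ_L HL)).
Notation actm N := (@rtens C [rm_obj N; img HL] [rm_obj N] (act N) _).

Lemma pL_iL l X Z (x : hom Z (in_context l (H ⊠ X))) : x ⟫[l] pL ⟫[l] iL = x ⟫[l] tgt.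
Proof. from_arrows (incl_proj HL) X. Qed.

Lemma iL_pL l X Z (x : hom Z (in_context l (HL ⊠ X))) : x ⟫[l] iL ⟫[l] pL = x.
Proof. from_arrows (proj_incl HL) X. Qed.

Lemma iL_tgt l X Z (x : hom Z (in_context l (HL ⊠ X))) : x ⟫[l] iL ⟫[l] tgt = x ⟫[l] iL.
Proof. by rewrite -pL_iL iL_pL. Qed.

Lemma tgt_pL l X Z (x : hom Z (in_context l (H ⊠ X))) : x ⟫[l] tgt ⟫[l] pL = x ⟫[l] pL.
Proof. by rewrite -pL_iL iL_pL. Qed.

Lemma iL_mul_de l X Z (x : hom Z (in_context l (HL ⊠ (H ⊠ X)))) :
  x ⟫[l] iL ⟫[l] mu ⟫[l] de = x ⟫[l] iL ⟫[H ·: l] de ⟫[l] mu.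
Proof. by have := tgt_mul_de (x ⟫[l] iL); rewrite !iL_tgt. Qed.

Lemma iL_mul_assoc l X Z (x : hom Z (in_context l (HL ⊠ (H ⊠ (H ⊠ X))))) :
  x ⟫[l] iL ⟫[l] mu ⟫[l] mu = x ⟫[l] iL ⟫[H ·: l] mu ⟫[l] mu.
Proof. by have := tgt_mul_assoc (x ⟫[l] iL); rewrite !iL_tgt. Qed.

Lemma iL_mul_tgt l X Z (x : hom Z (in_context l (HL ⊠ (H ⊠ X)))) :
  x ⟫[l] iL ⟫[l] mu ⟫[l] tgt = x ⟫[l] iL ⟫[H ·: l] tgt ⟫[l] mu.
Proof. by have := tgt_mul_tgt (x ⟫[l] iL); rewrite !iL_tgt. Qed.

Lemma actm_unit (N : modules) l X Z (x : hom Z (in_context l (rm_obj N ⊠ X))) :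
  x ⟫[rm_obj N ·: l] eta ⟫[rm_obj N ·: l] pL ⟫[l] actm N = x.
Proof.
have E := act_unit N; unfold η_L in E.
from_arrows E X.
Qed.

Lemma actm_assoc (N : modules) l X Z (x : hom Z (in_context l (rm_obj N ⊠ (HL ⊠ (HL ⊠ X))))) :
  x ⟫[l] actm N ⟫[l] actm N
  = x ⟫[rm_obj N ·: l] iL ⟫[H ·: rm_obj N ·: l] iL ⟫[rm_obj N ·: l] mu
      ⟫[rm_obj N ·: l] pL ⟫[l] actm N.
Proof.
have E := act_assoc N; unfold μ_L in E.
from_arrows E X.
Qed.

(** * The functor from strong Hopf modules to [H_L]-modules *)

Section Coinvariants.
Context (split_C : idempotents_split C).

Lemma q_idem (M : hopf_module H) : comp (q M) (q M) = q M.
Proof. by by_layers; rewrite qK. Qed.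

Definition q_splitting (M : hopf_module H) : splitting (q M) :=
  choose_inhabited (split_C (q_idem M)).

Lemma strong_iL (M : hopf_module H) l X Z
    (x : hom Z (in_context l (hm_obj M ⊠ (HL ⊠ (H ⊠ X))))) : is_strong HL M ->
  x ⟫[hm_obj M ·: l] iL ⟫[l] phi M ⟫[l] phi M
  = x ⟫[hm_obj M ·: l] iL ⟫[hm_obj M ·: l] mu ⟫[l] phi M.
Proof.
unfold is_strong => E.
from_arrows E X.
Qed.

Lemma strong_tgt (M : hopf_module H) : is_strong HL M ->
  forall l X Z (x : hom Z (in_context l (hm_obj M ⊠ (H ⊠ (H ⊠ X))))),
  x ⟫[hm_obj M ·: l] tgt ⟫[l] phi M ⟫[l] phi M
  = x ⟫[hm_obj M ·: l] tgt ⟫[hm_obj M ·: l] mu ⟫[l] phi M.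
Proof. by move=> sM l X Z x; rewrite -!pL_iL strong_iL. Qed.

Section Object.
Context (M : hopf_module H) (sM : is_strong HL M).
Notation S := (q_splitting M).
Notation iM := (@rtens C [img S] [hm_obj M] (incl S) _).
Notation pM := (@rtens C [hm_obj M] [img S] (proj S) _).

Lemma pM_iM l X Z (x : hom Z (in_context l (M ⊠ X))) : x ⟫[l] pM ⟫[l] iM = x ⟫[l] qq M.
Proof. from_arrows (incl_proj S) X. Qed.

Lemma iM_pM l X Z (x : hom Z (in_context l (S ⊠ X))) : x ⟫[l] iM ⟫[l] pM = x.
Proof. from_arrows (proj_incl S) X. Qed.

Lemma iM_q l X Z (x : hom Z (in_context l (S ⊠ X))) : x ⟫[l] iM ⟫[l] qq M = x ⟫[l] iM.
Proof. by rewrite -pM_iM iM_pM. Qed.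

Lemma q_pM l X Z (x : hom Z (in_context l (M ⊠ X))) : x ⟫[l] qq M ⟫[l] pM = x ⟫[l] pM.
Proof. by rewrite -pM_iM iM_pM. Qed.

Lemma iM_phi_q l X Z (x : hom Z (in_context l (S ⊠ (H ⊠ X)))) :
  x ⟫[l] iM ⟫[l] phi M ⟫[l] qq M = x ⟫[l] iM ⟫[hm_obj M ·: l] tgt ⟫[l] phi M.
Proof. by have := q_phi_q (x ⟫[l] iM); rewrite !iM_q. Qed.

Lemma iM_strong l X Z (x : hom Z (in_context l (S ⊠ (HL ⊠ (H ⊠ X))))) :
  x ⟫[S ·: l] iL ⟫[l] iM ⟫[l] phi M ⟫[l] phi M
  = x ⟫[S ·: l] iL ⟫[S ·: l] mu ⟫[l] iM ⟫[l] phi M.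
Proof. by shallow_first; rewrite strong_iL. Qed.

Definition coinv_act : hom (S ⊠ HL) S := proj S ∘ φ M ∘ (incl S ⊗ incl HL).
Notation aM := (@rtens C [img S; img HL] [img S] coinv_act _).

Lemma coinv_actE l X Z (x : hom Z (in_context l (S ⊠ (HL ⊠ X)))) :
  x ⟫[l] aM = x ⟫[l] iM ⟫[hm_obj M ·: l] iL ⟫[l] phi M ⟫[l] pM.
Proof.
have E : coinv_act = proj S ∘ φ M ∘ (incl S ⊗ incl HL) by [].
from_arrows E X.
Qed.

(** For [m] in the image of [q] and [y] in [H_L], [q(m y) = m Π(y) = m y], so the projection in
    [coinv_act] changes nothing. *)
Lemma coinv_act_iM l X Z (x : hom Z (in_context l (S ⊠ (HL ⊠ X)))) :
  x ⟫[l] aM ⟫[l] iM = x ⟫[l] iM ⟫[hm_obj M ·: l] iL ⟫[l] phi M.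
Proof.
rewrite coinv_actE pM_iM; deep_first; rewrite iM_phi_q; shallow_first.
by rewrite iL_tgt.
Qed.

Definition coinvariants : modules.
Proof.
refine (@RightModule C HL (η_L HL) (μ_L HL) S coinv_act _ _); unfold μ_L, η_L; by_layers.
- rewrite [LHS]coinv_actE coinv_act_iM; deep_first; rewrite iM_strong; shallow_first.
  rewrite coinv_actE; deep_first; rewrite pL_iL iL_mul_tgt; shallow_first.
  by rewrite iL_tgt.
- by rewrite coinv_actE; shallow_first; rewrite pL_iL tgt_unit phi_unit iM_pM.
Defined.

End Object.

Section Morphism.
Context (M N : hopf_module H) (f : hom M N) (f_hopf : is_hopf_morphism f).
Notation ff := (@rtens C [hm_obj M] [hm_obj N] f _).

Lemma hopf_rho l X Z (x : hom Z (in_context l (M ⊠ X))) :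
  x ⟫[l] ff ⟫[l] rho N = x ⟫[l] rho M ⟫[l] ff.
Proof. from_arrows (proj1 f_hopf) X. Qed.

Lemma hopf_phia l X Z (x : hom Z (in_context l (M ⊠ (H ⊠ X)))) :
  x ⟫[l] ff ⟫[l] phia N = x ⟫[l] phia M ⟫[l] ff.
Proof. from_arrows (proj2 f_hopf) X. Qed.

Lemma hopf_q l X Z (x : hom Z (in_context l (M ⊠ X))) :
  x ⟫[l] ff ⟫[l] qq N = x ⟫[l] qq M ⟫[l] ff.
Proof.
rewrite -phia_la hopf_rho; deep_first; rewrite hopf_phia.
by rewrite phia_la.
Qed.

(** [f] is only linear for [φα], but on the image of [q] strength makes [φα] agree with [φ]. *)
Lemma hopf_q_phi (sM : is_strong HL M) (sN : is_strong HL N)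
    l X Z (x : hom Z (in_context l (M ⊠ (H ⊠ X)))) :
  x ⟫[l] qq M ⟫[l] ff ⟫[l] phi N = x ⟫[l] qq M ⟫[l] phi M ⟫[l] ff.
Proof.
rewrite -[in RHS](q_phia (strong_tgt sM)) -hopf_phia -!hopf_q.
by rewrite (q_phia (strong_tgt sN)).
Qed.

Definition coinv_mor : hom (q_splitting M) (q_splitting N) :=
  proj (q_splitting N) ∘ f ∘ incl (q_splitting M).
Notation cf := (@rtens C [img (q_splitting M)] [img (q_splitting N)] coinv_mor _).
Notation iM := (@rtens C [img (q_splitting M)] [hm_obj M] (incl (q_splitting M)) _).
Notation pM := (@rtens C [hm_obj M] [img (q_splitting M)] (proj (q_splitting M)) _).
Notation iN := (@rtens C [img (q_splitting N)] [hm_obj N] (incl (q_splitting N)) _).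
Notation pN := (@rtens C [hm_obj N] [img (q_splitting N)] (proj (q_splitting N)) _).

Lemma coinv_morE l X Z (x : hom Z (in_context l (q_splitting M ⊠ X))) :
  x ⟫[l] cf = x ⟫[l] iM ⟫[l] ff ⟫[l] pN.
Proof.
have E : coinv_mor = proj (q_splitting N) ∘ f ∘ incl (q_splitting M) by [].
from_arrows E X.
Qed.

Lemma coinv_mor_iN l X Z (x : hom Z (in_context l (q_splitting M ⊠ X))) :
  x ⟫[l] cf ⟫[l] iN = x ⟫[l] iM ⟫[l] ff.
Proof. by rewrite coinv_morE pM_iM hopf_q iM_q. Qed.

Lemma iM_mor_phi (sM : is_strong HL M) (sN : is_strong HL N)
    l X Z (x : hom Z (in_context l (q_splitting M ⊠ (H ⊠ X)))) :
  x ⟫[l] iM ⟫[l] ff ⟫[l] phi N = x ⟫[l] iM ⟫[l] phi M ⟫[l] ff.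
Proof. by have := hopf_q_phi sM sN (x ⟫[l] iM); rewrite iM_q. Qed.

Lemma coinv_mor_module (sM : is_strong HL M) (sN : is_strong HL N) :
  is_module_morphism (N := coinvariants sM) (P := coinvariants sN) coinv_mor.
Proof.
rewrite /is_module_morphism /=; by_layers.
rewrite !coinv_actE coinv_mor_iN coinv_morE pM_iM -hopf_q q_pM; deep_first.
by rewrite iM_mor_phi.
Qed.

End Morphism.

Lemma coinv_mor_id (M : hopf_module H) : coinv_mor (idm (hm_obj M)) = idm (img (q_splitting M)).
Proof. by unfold coinv_mor; by_layers; rewrite iM_pM. Qed.

Lemma coinv_mor_comp (M N P : hopf_module H) (g : hom N P) (f : hom M N) :
  is_hopf_morphism f ->
  coinv_mor (comp g f) = comp (coinv_mor g) (coinv_mor f).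
Proof.
move=> f_hopf; apply: arrow_inj; unfold coinv_mor at 1; by_layers.
by rewrite [RHS]coinv_morE coinv_mor_iN.
Qed.

Definition coinvariants_functor :
  functor (strong_hopf_modules HL) (right_modules (η_L HL) (μ_L HL)).
Proof.
refine (@Functor (strong_hopf_modules HL) (right_modules (η_L HL) (μ_L HL))
  (fun M => coinvariants (proj2_sig M))
  (fun M N f => StructuredHom
    (coinv_mor_module (underlyingP f) (proj2_sig M) (proj2_sig N))) _ _).
- move=> M; apply: structured_hom_eq; exact: coinv_mor_id.
- move=> M N P g f; apply: structured_hom_eq; apply: coinv_mor_comp.
  exact: underlyingP.
Defined.

(** * The functor sending [N] to [N ⊗_{H_L} H] *)

Section Induction.
Context (coeq_C : has_coequalizers C).
Context (coeq_H : tensor_preserves_coequalizers (whq_obj H)).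

Section Object.
Context (N : modules).

Definition act_left : hom (N ⊠ HL ⊠ H) (N ⊠ H) := act N ⊗ idm H.
Definition act_right : hom (N ⊠ HL ⊠ H) (N ⊠ H) :=
  (idm N ⊗ μ) ∘ (idm N ⊗ incl HL ⊗ idm H).

Record coequalizer := Coequalizer {
  coeq_obj :> C;
  coeq_map : hom (N ⊠ H) coeq_obj;
  coeq_mapP : is_coequalizer act_left act_right coeq_map
}.

Definition tensor_HL : coequalizer.
Proof.
apply: choose_inhabited; have [Q [p pP]] := coeq_C act_left act_right.
by exists; exact: Coequalizer pP.
Qed.
Notation Q := (coeq_obj tensor_HL).
Notation p := (coeq_map tensor_HL).
Notation pN := (@rtens C [rm_obj N; whq_obj H] [coeq_obj tensor_HL] p _).

Lemma coeq_rel l X Z (x : hom Z (in_context l (N ⊠ (HL ⊠ (H ⊠ X))))) :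
  x ⟫[l] actm N ⟫[l] pN
  = x ⟫[rm_obj N ·: l] iL ⟫[rm_obj N ·: l] mu ⟫[l] pN.
Proof.
have := proj1 (coeq_mapP tensor_HL); unfold act_left, act_right => E.
from_arrows E X.
Qed.

Lemma coeq_epi : epi (rtens (a := [rm_obj N; whq_obj H]) (b := [Q]) p K).
Proof.
apply: epi_arrow (coequalizer_epi (coeq_mapP tensor_HL)).
by rewrite rtens_arrow tensm_unitr.
Qed.

(** [- ⊗ H] preserves the coequalizer, so maps out of [Q ⊠ H] are determined on [N ⊠ H ⊠ H]. *)
Lemma coeq_epi1 : epi (rtens (a := [rm_obj N; whq_obj H]) (b := [Q]) p (H ⊠ K)).
Proof.
apply: epi_arrow (coequalizer_epi (coeq_H (coeq_mapP tensor_HL))).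
by rewrite rtens_arrow; apply: tensm_arrow => //; rewrite tens_unitr.
Qed.

Lemma coeq_epi2 :
  epi (rtens (a := [rm_obj N; whq_obj H]) (b := [Q]) p (H ⊠ (H ⊠ K))).
Proof.
apply: epi_arrow (coequalizer_epi (coeq_H (coeq_H (coeq_mapP tensor_HL)))).
rewrite rtens_arrow tens_unitr -tensm_id tensm_assoc //.
Qed.

(** [(n ⊗ h) k = n ⊗ h k] is well defined because [(y h) k = y (h k)] for [y] in [H_L]. The identity
    factor inserts a cast to [N ⊠ (H ⊠ H)]. *)
Definition ind_act_sig :
  {u : hom (Q ⊠ H) Q | comp u (p ⊗ idm H) = p ∘ (idm N ⊗ μ) ∘ idm (N ⊠ H ⊠ H)}.
Proof.
apply: (coequalizer_desc (coeq_H (coeq_mapP tensor_HL))).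
unfold act_left, act_right; by_layers.
by deep_first; rewrite coeq_rel; shallow_first; rewrite iL_mul_assoc.
Qed.

Definition ind_act : hom (Q ⊠ H) Q := proj1_sig ind_act_sig.
Notation aQ := (@rtens C [coeq_obj tensor_HL; whq_obj H] [coeq_obj tensor_HL] ind_act _).

Lemma ind_actE l X Z (x : hom Z (in_context l (N ⊠ (H ⊠ (H ⊠ X))))) :
  x ⟫[l] pN ⟫[l] aQ = x ⟫[rm_obj N ·: l] mu ⟫[l] pN.
Proof.
have E : comp ind_act (p ⊗ idm H) = p ∘ (idm N ⊗ μ) ∘ idm (N ⊠ H ⊠ H)
  := proj2_sig ind_act_sig.
from_arrows E X.
Qed.

(** Well defined because [δ(y h) = y h1 ⊗ h2] for [y] in [H_L]. *)
Definition ind_coact_sig :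
  {u : hom Q (Q ⊠ H) | comp u p = (p ⊗ idm H) ∘ (idm N ⊗ δ)}.
Proof.
apply: (coequalizer_desc (coeq_mapP tensor_HL)).
unfold act_left, act_right; by_layers.
by deep_first; rewrite coeq_rel; shallow_first; rewrite iL_mul_de; shallow_first.
Qed.

Definition ind_coact : hom Q (Q ⊠ H) := proj1_sig ind_coact_sig.
Notation rQ := (@rtens C [coeq_obj tensor_HL] [coeq_obj tensor_HL; whq_obj H] ind_coact _).

Lemma ind_coactE l X Z (x : hom Z (in_context l (N ⊠ (H ⊠ X)))) :
  x ⟫[l] pN ⟫[l] rQ = x ⟫[rm_obj N ·: l] de ⟫[l] pN.
Proof.
have E : comp ind_coact p = (p ⊗ idm H) ∘ (idm N ⊗ δ) := proj2_sig ind_coact_sig.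
from_arrows E X.
Qed.

Lemma ind_comodule : is_comodule ind_coact.
Proof.
split.
- by by_layers_along coeq_epi; rewrite ind_coactE; deep_first; rewrite de_counitr.
- by by_layers_along coeq_epi; rewrite !ind_coactE; deep_first; rewrite de_coassoc.
Qed.

Definition induced : hopf_module H.
Proof.
refine (@HopfModule C H Q ind_act ind_coact ind_comodule _ _ _ _ _).
- by by_layers_along coeq_epi; deep_first; rewrite ind_actE mu_unitr.
- by_layers_along coeq_epi1; rewrite ind_actE !ind_coactE; deep_first.
  by rewrite ind_actE de_mul; deep_first.
- by_layers_along coeq_epi1; deep_first; rewrite !ind_actE.
  by shallow_first; rewrite mul_laK.
- by_layers_along coeq_epi1; deep_first; rewrite !ind_actE.
  by rewrite mul_laVK.
- by_layers_along coeq_epi1; deep_first; rewrite !ind_actE.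
  by rewrite mul_tgtK.
Defined.

(** The coequalizer map with codomain presented as [hm_obj induced], so that it composes with [φ]
    and [ρ] of [induced] without unfolding. *)
Definition ind_map : hom (N ⊠ H) (hm_obj induced) := coeq_map tensor_HL.
Notation pI := (@rtens C [rm_obj N; whq_obj H] [hm_obj induced] ind_map _).

Lemma ind_phi l X Z (x : hom Z (in_context l (N ⊠ (H ⊠ (H ⊠ X))))) :
  x ⟫[l] pI ⟫[l] phi induced = x ⟫[rm_obj N ·: l] mu ⟫[l] pI.
Proof. exact: ind_actE. Qed.

Lemma ind_rho l X Z (x : hom Z (in_context l (N ⊠ (H ⊠ X)))) :
  x ⟫[l] pI ⟫[l] rho induced = x ⟫[rm_obj N ·: l] de ⟫[l] pI.
Proof. exact: ind_coactE. Qed.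

Lemma ind_rel l X Z (x : hom Z (in_context l (N ⊠ (HL ⊠ (H ⊠ X))))) :
  x ⟫[l] actm N ⟫[l] pI
  = x ⟫[rm_obj N ·: l] iL ⟫[rm_obj N ·: l] mu ⟫[l] pI.
Proof. exact: coeq_rel. Qed.

Lemma ind_map_epi : epi ind_map.
Proof. exact: coequalizer_epi (coeq_mapP tensor_HL). Qed.

Lemma ind_epi : epi (rtens (a := [rm_obj N; whq_obj H]) (b := [hm_obj induced]) ind_map K).
Proof. exact: coeq_epi. Qed.

Lemma ind_epi1 :
  epi (rtens (a := [rm_obj N; whq_obj H]) (b := [hm_obj induced]) ind_map (H ⊠ K)).
Proof. exact: coeq_epi1. Qed.

Lemma ind_epi2 :
  epi (rtens (a := [rm_obj N; whq_obj H]) (b := [hm_obj induced]) ind_map (H ⊠ (H ⊠ K))).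
Proof. exact: coeq_epi2. Qed.

Lemma ind_desc (E : C) (h : hom (N ⊠ H) E) :
  comp h act_left = comp h act_right -> {u : hom (hm_obj induced) E | comp u ind_map = h}.
Proof. exact: coequalizer_desc (coeq_mapP tensor_HL). Qed.

Lemma ind_q l X Z (x : hom Z (in_context l (N ⊠ (H ⊠ X)))) :
  x ⟫[l] pI ⟫[l] qq induced = x ⟫[rm_obj N ·: l] tgt ⟫[l] pI.
Proof.
rewrite qE ind_rho; deep_first; rewrite ind_phi.
by rewrite -tgtE.
Qed.

Lemma ind_phia l X Z (x : hom Z (in_context l (N ⊠ (H ⊠ (H ⊠ X))))) :
  x ⟫[l] pI ⟫[l] phia induced = x ⟫[rm_obj N ·: l] mu ⟫[l] pI.
Proof.
rewrite phiaE ind_rho ind_q; deep_first; rewrite ind_phi; shallow_first.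
by rewrite -tgt_mul_assoc tgt_mulK.
Qed.

Lemma ind_strong : is_strong HL induced.
Proof.
(* Only [- ⊗ H] is assumed to preserve coequalizers, so the law is first proved for [target H] on
   [H], then restricted along [incl HL]. *)
have E : φ induced ∘ ((φ induced ∘ (idm (hm_obj induced) ⊗ target H)) ⊗ idm H)
    ≈ φ induced ∘ (idm (hm_obj induced) ⊗ (μ ∘ (target H ⊗ idm H))).
  by_layers_along ind_epi2; deep_first; rewrite !ind_phi.
  by rewrite mul_tgt_assoc.
have tgt_strong Z (x : hom Z (in_context [] (hm_obj induced ⊠ (H ⊠ (H ⊠ K))))) :
    x ⟫[[hm_obj induced]] tgt ⟫[[]] phi induced ⟫[[]] phi induced
    = x ⟫[[hm_obj induced]] tgt ⟫[[hm_obj induced]] mu ⟫[[]] phi induced.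
  from_arrows E (unit_obj : C).
unfold is_strong; by_layers.
by have := tgt_strong _ (x ⟫[[hm_obj induced]] iL); rewrite !iL_tgt.
Qed.

End Object.

Section IndMorphism.
Context (N P : modules) (f : hom N P) (f_mod : is_module_morphism f).
Notation ff := (@rtens C [rm_obj N] [rm_obj P] f _).
Notation pN := (@rtens C [rm_obj N; whq_obj H] [hm_obj (induced N)] (ind_map N) _).
Notation pP := (@rtens C [rm_obj P; whq_obj H] [hm_obj (induced P)] (ind_map P) _).

Lemma module_mor_act l X Z (x : hom Z (in_context l (rm_obj N ⊠ (HL ⊠ X)))) :
  x ⟫[l] ff ⟫[l] actm P = x ⟫[l] actm N ⟫[l] ff.
Proof. from_arrows f_mod X. Qed.

Definition ind_mor_sig :
  {u : hom (hm_obj (induced N)) (hm_obj (induced P)) |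
    comp u (ind_map N) = ind_map P ∘ (f ⊗ idm H)}.
Proof.
apply: ind_desc; unfold act_left, act_right; by_layers.
by rewrite -module_mor_act ind_rel; shallow_first.
Qed.

Definition ind_mor : hom (hm_obj (induced N)) (hm_obj (induced P)) :=
  proj1_sig ind_mor_sig.
Notation fi := (@rtens C [hm_obj (induced N)] [hm_obj (induced P)] ind_mor _).

Lemma ind_morP : comp ind_mor (ind_map N) = ind_map P ∘ (f ⊗ idm H).
Proof. exact: proj2_sig ind_mor_sig. Qed.

Lemma ind_morE l X Z (x : hom Z (in_context l (rm_obj N ⊠ (H ⊠ X)))) :
  x ⟫[l] pN ⟫[l] fi = x ⟫[l] ff ⟫[l] pP.
Proof.
from_arrows ind_morP X.
Qed.

Lemma ind_mor_hopf : is_hopf_morphism ind_mor.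
Proof.
split.
- by_layers_along (@ind_epi N); rewrite ind_morE !ind_rho.
  by deep_first; rewrite ind_morE.
- by_layers_along (@ind_epi1 N); rewrite ind_morE !ind_phia; deep_first.
  by rewrite ind_morE.
Qed.

End IndMorphism.

Lemma ind_mor_id (N : modules) (idN : is_module_morphism (idm (rm_obj N))) :
  ind_mor idN = idm (hm_obj (induced N)).
Proof.
apply: (@ind_map_epi N).
by rewrite ind_morP comp_idl /strict_comp /= tensm_id comp_idr.
Qed.

Lemma ind_mor_comp (N P R : modules) (g : hom P R) (f : hom N P)
    (g_mod : is_module_morphism g) (f_mod : is_module_morphism f)
    (gf_mod : is_module_morphism (comp g f)) :
  ind_mor gf_mod = comp (ind_mor g_mod) (ind_mor f_mod).
Proof.
apply: (@ind_map_epi N); rewrite ind_morP; by_layers.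
by rewrite !ind_morE.
Qed.

Definition induction_functor :
  functor (right_modules (η_L HL) (μ_L HL)) (strong_hopf_modules HL).
Proof.
refine (@Functor (right_modules (η_L HL) (μ_L HL)) (strong_hopf_modules HL)
  (fun N => exist _ (induced N) (ind_strong N))
  (fun N P f => StructuredHom (ind_mor_hopf (underlyingP f))) _ _).
- move=> N; apply: structured_hom_eq; exact: ind_mor_id.
- move=> N P R g f; apply: structured_hom_eq; exact: ind_mor_comp.
Defined.

(** * The isomorphism from [im q ⊗_{H_L} H] to [M] *)

Section Counit.
Context (M : hopf_module H) (sM : is_strong HL M).
Notation S := (coinvariants sM).
Notation FM := (induced (coinvariants sM)).
Definition coinv_incl : hom (rm_obj S) (hm_obj M) := incl (q_splitting M).
Definition coinv_proj : hom (hm_obj M) (rm_obj S) := proj (q_splitting M).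
Notation iM := (@rtens C [rm_obj S] [hm_obj M] coinv_incl _).
Notation pM := (@rtens C [hm_obj M] [rm_obj S] coinv_proj _).
Notation pI := (@rtens C [rm_obj S; whq_obj H] [hm_obj FM] (ind_map S) _).

Lemma coinv_proj_incl l X Z (x : hom Z (in_context l (M ⊠ X))) :
  x ⟫[l] pM ⟫[l] iM = x ⟫[l] qq M.
Proof. exact: pM_iM. Qed.

Lemma coinv_q_proj l X Z (x : hom Z (in_context l (M ⊠ X))) :
  x ⟫[l] qq M ⟫[l] pM = x ⟫[l] pM.
Proof. exact: q_pM. Qed.

Lemma coinv_incl_q l X Z (x : hom Z (in_context l (rm_obj S ⊠ X))) :
  x ⟫[l] iM ⟫[l] qq M = x ⟫[l] iM.
Proof. exact: iM_q. Qed.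

Lemma coinv_incl_phi_q l X Z (x : hom Z (in_context l (rm_obj S ⊠ (H ⊠ X)))) :
  x ⟫[l] iM ⟫[l] phi M ⟫[l] qq M = x ⟫[l] iM ⟫[hm_obj M ·: l] tgt ⟫[l] phi M.
Proof. exact: iM_phi_q. Qed.

Lemma coinv_actmE l X Z (x : hom Z (in_context l (rm_obj S ⊠ (HL ⊠ X)))) :
  x ⟫[l] actm S = x ⟫[rm_obj S ·: l] iL ⟫[l] iM ⟫[l] phi M ⟫[l] pM.
Proof. by shallow_first; exact: coinv_actE. Qed.

Lemma coinv_actm_incl l X Z (x : hom Z (in_context l (rm_obj S ⊠ (HL ⊠ X)))) :
  x ⟫[l] actm S ⟫[l] iM = x ⟫[l] iM ⟫[hm_obj M ·: l] iL ⟫[l] phi M.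
Proof. exact: coinv_act_iM. Qed.

Lemma coinv_incl_rho l X Z (x : hom Z (in_context l (rm_obj S ⊠ (H ⊠ X)))) :
  x ⟫[l] iM ⟫[l] phi M ⟫[l] rho M = x ⟫[l] iM ⟫[hm_obj M ·: l] de ⟫[l] phi M.
Proof. by have := rho_phi_q (x ⟫[l] iM); rewrite !coinv_incl_q. Qed.

Lemma coinv_incl_phia l X Z (x : hom Z (in_context l (rm_obj S ⊠ (H ⊠ (H ⊠ X))))) :
  x ⟫[l] iM ⟫[l] phi M ⟫[l] phia M = x ⟫[l] iM ⟫[hm_obj M ·: l] mu ⟫[l] phi M.
Proof. by have := q_phi_phia (strong_tgt sM) (x ⟫[l] iM); rewrite !coinv_incl_q. Qed.

Definition counit_sig :
  {u : hom (hm_obj FM) (hm_obj M) |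
    comp u (ind_map S) = φ M ∘ (coinv_incl ⊗ idm H)}.
Proof.
apply: ind_desc; unfold act_left, act_right; by_layers.
by rewrite coinv_actm_incl strong_iL //; shallow_first.
Qed.

Definition counit : hom (hm_obj FM) (hm_obj M) := proj1_sig counit_sig.
Notation al := (@rtens C [hm_obj FM] [hm_obj M] counit _).

Lemma counitP : comp counit (ind_map S) = φ M ∘ (coinv_incl ⊗ idm H).
Proof. exact: proj2_sig counit_sig. Qed.

Lemma counitE l X Z (x : hom Z (in_context l (rm_obj S ⊠ (H ⊠ X)))) :
  x ⟫[l] pI ⟫[l] al = x ⟫[l] iM ⟫[l] phi M.
Proof. from_arrows counitP X. Qed.

Lemma counit_hopf : is_hopf_morphism counit.
Proof.
split.
- by_layers_along (@ind_epi S); rewrite counitE coinv_incl_rho ind_rho; deep_first.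
  by rewrite counitE.
- by_layers_along (@ind_epi1 S); rewrite counitE coinv_incl_phia ind_phia; deep_first.
  by rewrite counitE.
Qed.

Definition counit_inv : hom (hm_obj M) (hm_obj FM) :=
  ind_map S ∘ (coinv_proj ⊗ idm H) ∘ ρ M.
Notation be := (@rtens C [hm_obj M] [hm_obj FM] counit_inv _).

Lemma counit_invE l X Z (x : hom Z (in_context l (hm_obj M ⊠ X))) :
  x ⟫[l] be = x ⟫[l] rho M ⟫[l] pM ⟫[l] pI.
Proof.
have E : counit_inv = ind_map S ∘ (coinv_proj ⊗ idm H) ∘ ρ M by [].
from_arrows E X.
Qed.

(** For [m] in the image of [q], [m ⊗ h] goes to [q(m h1) ⊗ h2 = m Π(h1) ⊗ h2 = m ⊗ Π(h1) h2 = m ⊗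
    h]. *)
Lemma counitK : comp counit_inv counit = idm (hm_obj FM).
Proof.
by_layers_along (@ind_epi S); rewrite counitE counit_invE coinv_incl_rho.
rewrite -coinv_q_proj; deep_first; rewrite coinv_incl_phi_q -pL_iL; deep_first.
by rewrite -coinv_actmE ind_rel; shallow_first; rewrite pL_iL tgt_mulK.
Qed.

Lemma counit_invK : comp counit counit_inv = idm (hm_obj M).
Proof.
by by_layers; rewrite counit_invE counitE coinv_proj_incl rho_q_phi.
Qed.

End Counit.

Lemma hopf_morphism_inv (M N : hopf_module H) (f : hom M N) (g : hom N M) :
  is_hopf_morphism f -> comp g f = idm (hm_obj M) -> comp f g = idm (hm_obj N) ->
  is_hopf_morphism g.
Proof.
rewrite /is_hopf_morphism /strict_comp /= => -[f_rho f_phi] gf fg.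
have gfH : comp (g ⊗ idm H) (f ⊗ idm H) = idm (hm_obj M ⊠ H).
  by rewrite -tensm_comp gf comp_idl tensm_id.
have fgH : comp (f ⊗ idm H) (g ⊗ idm H) = idm (hm_obj N ⊠ H).
  by rewrite -tensm_comp fg comp_idl tensm_id.
split.
- rewrite -[LHS]comp_idl -gfH -comp_assoc (comp_assoc (f ⊗ _)) -f_rho.
  by rewrite -comp_assoc fg comp_idr.
- rewrite -[LHS]comp_idl -gf -comp_assoc (comp_assoc f) -f_phi.
  by rewrite -comp_assoc fgH comp_idr.
Qed.

Lemma module_morphism_inv (N P : modules) (f : hom N P) (g : hom P N) :
  is_module_morphism f -> comp g f = idm (rm_obj N) -> comp f g = idm (rm_obj P) ->
  is_module_morphism g.
Proof.
rewrite /is_module_morphism /strict_comp /= => f_act gf fg.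
have fgH : comp (f ⊗ idm HL) (g ⊗ idm HL) = idm (rm_obj P ⊠ HL).
  by rewrite -tensm_comp fg comp_idl tensm_id.
rewrite -[LHS]comp_idl -gf -comp_assoc (comp_assoc f) -f_act.
by rewrite -comp_assoc fgH comp_idr.
Qed.

(** * The isomorphism between [N] and the image of [q] on [N ⊗_{H_L} H] *)

Section Unit.
Context (N : modules).
Notation Q := (induced N).
Notation GQ := (coinvariants (ind_strong N)).
Notation pI := (@rtens C [rm_obj N; whq_obj H] [hm_obj Q] (ind_map N) _).
Notation pQ := (@rtens C [hm_obj Q] [rm_obj GQ] (coinv_proj (ind_strong N)) _).

(** [n ⊗ h ↦ n Π(h)] is well defined: [(n y) Π(h) = n (y Π(h)) = n Π(y h)]. *)
Definition ind_ret_sig :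
  {u : hom (hm_obj Q) (rm_obj N) | comp u (ind_map N) = act N ∘ (idm N ⊗ proj HL)}.
Proof.
apply: ind_desc; unfold act_left, act_right; by_layers.
deep_first; rewrite actm_assoc; shallow_first.
by rewrite pL_iL -iL_mul_tgt tgt_pL.
Qed.

Definition ind_ret : hom (hm_obj Q) (rm_obj N) := proj1_sig ind_ret_sig.
Notation vv := (@rtens C [hm_obj Q] [rm_obj N] ind_ret _).

Lemma ind_retP : comp ind_ret (ind_map N) = act N ∘ (idm N ⊗ proj HL).
Proof. exact: proj2_sig ind_ret_sig. Qed.

Lemma ind_retE l X Z (x : hom Z (in_context l (rm_obj N ⊠ (H ⊠ X)))) :
  x ⟫[l] pI ⟫[l] vv = x ⟫[rm_obj N ·: l] pL ⟫[l] actm N.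
Proof. from_arrows ind_retP X. Qed.

Definition unit_inv : hom (rm_obj GQ) (rm_obj N) :=
  comp ind_ret (coinv_incl (ind_strong N)).

(* The last factor inserts the cast from [N] to [N ⊠ K]. *)
Definition unit_map : hom (rm_obj N) (rm_obj GQ) :=
  coinv_proj (ind_strong N) ∘ ind_map N ∘ (idm (rm_obj N) ⊗ η) ∘ idm (rm_obj N).
Notation uu := (@rtens C [rm_obj N] [rm_obj GQ] unit_map _).

Lemma unit_mapE l X Z (x : hom Z (in_context l (rm_obj N ⊠ X))) :
  x ⟫[l] uu = x ⟫[rm_obj N ·: l] eta ⟫[l] pI ⟫[l] pQ.
Proof.
have E : unit_map = coinv_proj (ind_strong N) ∘ ind_map N ∘ (idm (rm_obj N) ⊗ η)
  ∘ idm (rm_obj N) by [].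
from_arrows E X.
Qed.

(** Before projection, [n Π(h) ⊗ 1 = n ⊗ Π(h) = q(n ⊗ h)]. *)
Lemma ind_ret_unit : comp unit_map ind_ret = coinv_proj (ind_strong N).
Proof.
by_layers_along (@ind_epi N); rewrite ind_retE unit_mapE; deep_first.
rewrite ind_rel; shallow_first.
by rewrite pL_iL mu_unitr -ind_q coinv_q_proj.
Qed.

Lemma unitK : comp unit_inv unit_map = idm (rm_obj N).
Proof.
unfold unit_inv; by_layers; rewrite unit_mapE coinv_proj_incl ind_q ind_retE.
by rewrite tgt_unit actm_unit.
Qed.

Lemma unit_invK : comp unit_map unit_inv = idm (rm_obj GQ).
Proof.
rewrite /unit_inv comp_assoc ind_ret_unit.
exact: proj_incl.
Qed.

Lemma unit_map_module : is_module_morphism unit_map.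
Proof.
rewrite /is_module_morphism; by_layers; rewrite !unit_mapE coinv_actmE.
deep_first.
rewrite coinv_proj_incl ind_q tgt_unit ind_phi mu_unitl ind_rel; shallow_first.
by rewrite mu_unitr.
Qed.

Lemma unit_inv_module : is_module_morphism unit_inv.
Proof. exact: module_morphism_inv unit_map_module unitK unit_invK. Qed.

End Unit.

(** On [m ⊗ h] with [m] in the image of [q] this is [f(m) h = f(m h)]. *)
Lemma counit_natural (M N : hopf_module H) (sM : is_strong HL M)
    (sN : is_strong HL N) (f : hom M N)
    (f_mod : is_module_morphism (N := coinvariants sM) (P := coinvariants sN) (coinv_mor f)) :
  is_hopf_morphism f ->
  comp (counit sN) (ind_mor f_mod) = comp f (counit sM).
Proof.
move=> f_hopf; by_layers_along (@ind_epi (coinvariants sM)).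
rewrite ind_morE !counitE (coinv_mor_iN f_hopf).
by rewrite iM_mor_phi.
Qed.

Lemma unit_natural (N P : modules) (f : hom N P) (f_mod : is_module_morphism f) :
  comp (unit_inv P) (coinv_mor (ind_mor f_mod)) = comp f (unit_inv N).
Proof.
(* Naturality already holds before restriction to the image of [q], where it reads
   [f(n) Π(h) = f(n Π(h))]. *)
have ret_nat : comp (ind_ret P) (ind_mor f_mod) = comp f (ind_ret N).
  by_layers_along (@ind_epi N); rewrite ind_morE !ind_retE; deep_first.
  by rewrite (module_mor_act f_mod).
unfold unit_inv; rewrite comp_assoc -ret_nat -!comp_assoc; congr comp.
by_layers.
exact: (coinv_mor_iN (ind_mor_hopf f_mod)).
Qed.

End Induction.
End Coinvariants.
End Equivalence.
End WeakHopfQuasigroup.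

Theorem theorem3p10 (C : strict_braided)
  (split_C : idempotents_split C) (coeq_C : has_coequalizers C)
  (H : weak_hopf_quasigroup C)
  (coeq_H : tensor_preserves_coequalizers (whq_obj H))
  (HL : splitting (target H)) :
  equivalent (strong_hopf_modules HL) (right_modules (η_L HL) (μ_L HL)).
Proof.
exists (coinvariants_functor HL split_C), (induction_functor HL coeq_C coeq_H).
split.
- exists (fun M => StructuredHom
    (counit_hopf split_C coeq_C coeq_H (proj2_sig M) : is_hopf_morphism _)).
  split=> [M N f | M].
  + apply: structured_hom_eq; apply: counit_natural; exact: underlyingP.
  + exists (StructuredHom (hopf_morphism_inv
      (counit_hopf split_C coeq_C coeq_H (proj2_sig M))
      (counitK split_C coeq_C coeq_H (proj2_sig M))
      (counit_invK split_C coeq_C coeq_H (proj2_sig M)))).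
    split; apply: structured_hom_eq; [exact: counitK | exact: counit_invK].
- exists (fun N => StructuredHom (unit_inv_module split_C coeq_C coeq_H N)).
  split=> [N P f | N].
  + apply: structured_hom_eq; exact: unit_natural.
  + exists (StructuredHom (unit_map_module split_C coeq_C coeq_H N)).
    split; apply: structured_hom_eq; [exact: unit_invK | exact: unitK].
Qed.
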